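(* Let $C$ be a nonempty convex subset of $X$, let $F\colon X\to Y\cup\{+\infty_Y\}$ be a proper $K$-convex mapping, and let $G\colon X\to Z\cup\{+\infty_Z\}$ be a proper $S$-convex mapping. Let $A:=C\cap G^{-1}(-S)$, $E:=G(C\cap\operatorname{dom}F\cap\operatorname{dom}G)+S$, and let $\bar x\in A\cap\operatorname{dom}F$. Assume that one of the following conditions holds: $(c_1)$ there exists $x_0\in C\cap\operatorname{dom}F$ such that $G(x_0)\in-\operatorname{int}S$; $(c_2)$ $X,Z$ are Fréchet spaces, $C$ is closed, $y^*\circ F$ is lower semicontinuous for all $y^*\in Y^*$, $G$ is $S$-epi closed and $0_Z\in\operatorname{sqri}E$; $(c_3)$ $\dim\operatorname{lin}E<+\infty$ and $0_Z\in\operatorname{ri}E$. Then both of the following hold: $(f)$ $\bar x$ is a weak solution of $(\mathrm{VOP})$ if and only if there exists $T\in\mathcal{L}_+(S,K)$ such that $$-F(\bar x)\in(F+I_C+T\circ G)^*(0_{\mathcal{L}})+K.$$ $(g)$ $\bar x$ is a weak solution of $(\mathrm{VOP})$ if and only if there exists $T\in\mathcal{L}_+(S,K)$ such that $$F(x)+(T\circ G)(x)-F(\bar x)\notin-\operatorname{int}K,\quad\forall x\in C.$$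
   Context: $X,Y,Z$ are (real) locally convex Hausdorff topological vector spaces with topological duals $X^*,Y^*,Z^*$; $K\subset Y$ is a closed, pointed, convex cone with $\operatorname{int}K\neq\emptyset$; $S\subset Z$ is a nonempty closed convex cone. Order and infinite elements: for $y_1,y_2\in Y$, $y_1<_K y_2$ means $y_1-y_2\in-\operatorname{int}K$. $Y^\bullet:=Y\cup\{-\infty_Y,+\infty_Y\}$, where $\pm\infty_Y\notin Y$ and $-\infty_Y<_K y<_K+\infty_Y$ for all $y\in Y$ (hence also $-\infty_Y<_K+\infty_Y$). Conventions: $-(+\infty_Y)=-\infty_Y$, $-(-\infty_Y)=+\infty_Y$, $(+\infty_Y)+y=y+(+\infty_Y)=+\infty_Y$ for $y\in Y\cup\{+\infty_Y\}$, $(-\infty_Y)+y=y+(-\infty_Y)=-\infty_Y$ for $y\in Y\cup\{-\infty_Y\}$. Analogous elements $\pm\infty_Z$ and conventions are used for $Z$ (ordered by $S$). Weak supremum/infimum: for $\emptyset\neq M\subset Y^\bullet$, $\operatorname{WSup}M$ is the set of $\bar v\in Y^\bullet$ such that $\bar v\not<_K v$ for all $v\in M$, and for every $\tilde v\in Y^\bullet$ with $\tilde v<_K\bar v$ there is $v\in M$ with $\tilde v<_K v$. $\operatorname{WInf}M$ is the set of $\bar v\in Y^\bullet$ such that $v\not<_K\bar v$ for all $v\in M$, and for every $\tilde v\in Y^\bullet$ with $\bar v<_K\tilde v$ there is $v\in M$ with $v<_K\tilde v$. $\operatorname{WMin}M=M\cap\operatorname{WInf}M$. $(\mathrm{VOP})$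 is the problem $\operatorname{WMin}\{F(x): x\in C,\ G(x)\in-S\}$, and $\bar x\in A$ is a weak solution of $(\mathrm{VOP})$ if $F(\bar x)\in\operatorname{WMin}F(A)$. Mappings: for $F\colon X\to Y^\bullet$, $\operatorname{dom}F=\{x\in X: F(x)\neq+\infty_Y\}$; $F$ is proper if $\operatorname{dom}F\neq\emptyset$ and $-\infty_Y\notin F(X)$; $\operatorname{epi}_KF=\{(x,y)\in X\times Y: y\in F(x)+K\}$; $F$ is $K$-convex if $\operatorname{epi}_KF$ is convex, and $K$-epi closed if it is closed. The same notions are used for $G$ with $(Z,S)$ in place of $(Y,K)$. For $y^*\in Y^*$, $(y^*\circ F)(x)=y^*(F(x))$ if $F(x)\in Y$ and $+\infty$ if $F(x)=+\infty_Y$. $\mathcal{L}(X,Y)$ is the space of continuous linear mappings $X\to Y$; $0_{\mathcal{L}}$ is its zero element. The conjugate of $F$ is the set-valued map $F^*(L)=\operatorname{WSup}\{L(x)-F(x):x\in X\}$, $L\in\mathcal{L}(X,Y)$. For $D\subset X$, $I_D(x)=0_Y$ if $x\in D$ and $I_D(x)=+\infty_Y$ otherwise. For $T\in\mathcal{L}(Z,Y)$, $(T\circ G)(x)=T(G(x))$ if $G(x)\in Z$ and $+\infty_Y$ if $G(x)=+\infty_Z$. $\mathcal{L}_+(S,K)=\{T\in\mathcal{L}(Z,Y): T(S)\subset K\}$. For a convex set $U$: $\operatorname{lin}U$ is its linear hull, $\operatorname{ri}U$ its relative interior (interior relative to its affine hull), and $\operatorname{sqri}U$ its strong quasi-relative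 interior, i.e. the set of $u\in U$ such that the cone $\bigcup_{\lambda\ge 0}\lambda(U-u)$ is a closed linear subspace. *)

(* Defs.v *)
From HB Require Import structures.
From mathcomp Require Import all_boot all_order all_algebra.
From mathcomp Require Import all_classical all_reals all_analysis.

Set Implicit Arguments.
Unset Strict Implicit.
Unset Printing Implicit Defensive.

Import Order.TTheory GRing.Theory Num.Theory.
Import numFieldNormedType.Exports.

Local Open Scope classical_set_scope.
Local Open Scope ring_scope.

(* Throughout, [tvsType R] is the library's locally convex topological vector
   space; it is not Hausdorff by itself. *)

Section convex_sets.
Context {R : realType} {V : tvsType R}.
Implicit Types U K : set V.

Definition cone K := forall (t : R) x, 0 <= t -> K x -> K (t *: x).

Definition pointed_cone K := K `&` (-%R @` K) = [set 0].

Definition affine_set U :=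
  forall (t : R) x y, U x -> U y -> U (t *: x + (1 - t) *: y).

Definition linear_subspace U := submod_closed (mem U).

Definition aff U : set V := smallest affine_set U.

Definition lin U : set V := smallest linear_subspace U.

Definition finite_dim U :=
  exists (n : nat) (e : 'I_n -> V), U = lin (range e).

(* [subspace (aff U)] carries the topology induced on [aff U], extended to all
   of V by making the other points isolated; as U is included in [aff U], these
   points play no role. *)
Definition ri U : set V := (U : set (subspace (aff U)))°.

Definition conic U (u : V) : set V :=
  [set t *: (v - u) | t in [set t : R | 0 <= t] & v in U].

Definition sqri U : set V :=
  [set u | [/\ U u, linear_subspace (conic U u) & closed (conic U u)]].

End convex_sets.

(* Completeness is expressed with an invariant metric rather than with the
   library's Cauchy filters: the uniform structure of a [tvsType] induces its
   topology but is not required to be translation invariant. *)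
Definition frechet {R : realType} (V : tvsType R) :=
  exists d : V -> V -> R,
    [/\ [/\ forall x y, d x y = 0 <-> x = y,
            forall x y, d x y = d y x,
            forall x y z, d x z <= d x y + d y z
          & forall x y z, d (x + z) (y + z) = d x y],
        forall x, nbhs x = filter_from [set e : R | 0 < e]
                             (fun e => [set y | d x y < e])
      & forall u : nat -> V,
          (forall e : R, 0 < e ->
             exists N, forall m n, (N <= m)%N -> (N <= n)%N ->
               d (u m) (u n) < e) ->
          exists l : V, u @ \oo --> l].

Record contlin (R : realType) (X Y : tvsType R) := ContLin {
  contlin_fun :> {linear X -> Y};
  contlin_continuous : continuous contlin_fun }.

Definition contlin0 (R : realType) (X Y : tvsType R) : contlin X Y :=
  @ContLin R X Y \0 (fun x => @cst_continuous X Y 0 x).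

Inductive ext (V : Type) := MInfty | Fin of V | PInfty.
Arguments MInfty {V}.
Arguments Fin {V}.
Arguments PInfty {V}.

Section extended.
Context {R : realType} {Y : tvsType R}.
Implicit Types (K : set Y) (M N : set (ext Y)).

Definition ext_opp (y : ext Y) : ext Y :=
  match y with
  | MInfty => PInfty
  | Fin y => Fin (- y)
  | PInfty => MInfty
  end.

(* The sum of -oo and +oo is normally left undefined; its value here is arbitrary. *)
Definition ext_add (y1 y2 : ext Y) : ext Y :=
  match y1, y2 with
  | PInfty, _ | _, PInfty => PInfty
  | MInfty, _ | _, MInfty => MInfty
  | Fin y1, Fin y2 => Fin (y1 + y2)
  end.

Definition ext_lt K (y1 y2 : ext Y) : Prop :=
  match y1, y2 with
  | MInfty, MInfty => False
  | MInfty, _ => True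
  | Fin y1, Fin y2 => (-%R @` K°) (y1 - y2)
  | Fin _, PInfty => True
  | _, _ => False
  end.

Definition plus_set M (D : set Y) : set (ext Y) :=
  [set ext_add m (Fin k) | m in M & k in D].

Definition WSup K M : set (ext Y) :=
  [set v | (forall w, M w -> ~ ext_lt K v w) /\
           (forall v', ext_lt K v' v -> exists2 w, M w & ext_lt K v' w)].

Definition WInf K M : set (ext Y) :=
  [set v | (forall w, M w -> ~ ext_lt K w v) /\
           (forall v', ext_lt K v v' -> exists2 w, M w & ext_lt K w v')].

Definition WMin K M : set (ext Y) := M `&` WInf K M.

End extended.

Section mappings.
Context {R : realType} {X Y : tvsType R}.
Implicit Types (F H : X -> ext Y) (K : set Y).

Definition dom F : set X := [set x | F x <> PInfty].

Definition proper_map F := dom F !=set0 /\ forall x, F x <> MInfty.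

Definition epi K F : set (X * Y) :=
  [set p | plus_set [set F p.1] K (Fin p.2)].

Definition K_convex K F :=
  convex_set (epi K F : set (convex_lmodType (X * Y)%type)).

Definition K_epi_closed K F := closed (epi K F).

(* The value at -oo is irrelevant for mappings that avoid it. *)
Definition dual_comp (ystar : contlin Y R^o) F (x : X) : \bar R :=
  match F x with
  | MInfty => -oo%E
  | Fin y => (ystar y)%:E
  | PInfty => +oo%E
  end.

Definition ext_indic (D : set X) : X -> ext Y :=
  fun x => if x \in D then Fin 0 else PInfty.

Definition map_add F H : X -> ext Y := fun x => ext_add (F x) (H x).

Definition conjugate K F (L : contlin X Y) : set (ext Y) :=
  WSup K (range (fun x => ext_add (Fin (L x)) (ext_opp (F x)))).

End mappings.

Definition lin_comp {R : realType} {X Y Z : tvsType R}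
    (T : contlin Z Y) (G : X -> ext Z) : X -> ext Y :=
  fun x => match G x with
           | MInfty => MInfty
           | Fin z => Fin (T z)
           | PInfty => PInfty
           end.

Section vector_optimization.
Context {R : realType} {X Y Z : tvsType R}.
Variables (C : set X) (F : X -> ext Y) (G : X -> ext Z).
Variables (K : set Y) (S : set Z).

Definition positive_operators : set (contlin Z Y) :=
  [set T | (fun z => T z) @` S `<=` K].

Definition feasible : set X := C `&` G @^-1` (Fin @` (-%R @` S)).

(* [plus_set _ S] lives in the extended space; its elements here are all
   finite when G avoids -oo. *)
Definition value_set : set Z :=
  Fin @^-1` plus_set (G @` (C `&` dom F `&` dom G)) S.

Definition weak_solution : set X :=
  [set x | feasible x /\ WMin K (F @` feasible) (F x)].

End vector_optimization.

(* Main.v *)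
Require Import Defs.
From HB Require Import structures.
From mathcomp Require Import all_boot all_order all_algebra.
From mathcomp Require Import all_classical all_reals all_analysis.
From mathcomp Require Import ring lra.

Import Order.TTheory GRing.Theory Num.Theory.
Import numFieldNormedType.Exports.

Local Open Scope classical_set_scope.
Local Open Scope ring_scope.

(** Fix xbar feasible with F xbar = ybar finite. Weak optimality says that no
    feasible x has F x - ybar in -int K. Both characterizations rest on the
    same pointwise condition on T, F x + T (G x) - ybar not in -int K for all x
    in C. For a fixed T it is equivalent to the one with the conjugate: at xbar
    the Lagrangian value ybar + T (G xbar) lies in ybar - K, which makes -ybar
    itself a member of the weak supremum ([lagrange_conditionE]). It implies
    optimality because T (G x) is in -K when x is feasible. The substance is
    the converse, the existence of T.

    The proof scalarizes first. [scalarization] separates the convex set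
    F(A) - ybar + K from -int K and gives a continuous functional f, positive on
    int K, such that xbar minimizes f o F over the feasible set. It remains to
    find a Lagrange multiplier g for this scalar problem, that is a continuous
    g, nonnegative on S, with f (F x) + g (G x) >= f ybar on C; then
    T z = g z *: (k0 / f k0), for k0 in int K, satisfies f o T = g, and f being
    positive on int K, T is as wanted. Up to sign, g is a subgradient at 0 of
    the value function v z = inf { f (F x) - f ybar | x in C, z in G x + S },
    whose domain is E. As v is convex with v 0 = 0, it suffices that v be bounded
    above on W /\ L, where W is a neighborhood of 0 and L a linear subspace
    containing E: convexity along the segment from u to - u / c then bounds v
    below by minus a multiple of the gauge of - W, and a Hahn-Banach argument
    inserts a linear functional between the two
    ([bounded_value_subgradient]).

    Each regularity condition yields such a bound. If G x0 is in -int S, the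
    single point x0 is admissible for all z near 0, and L is the whole space
    ([interior_multiplier]). In the other two cases E is absorbing in L. By
    convexity so is the set P of those z such that z in G x + S for some x in C
    with f (F x) - f ybar <= 1, and one must pass from absorbing to
    neighborhood. For L finite dimensional, convexity of P is enough
    ([finite_dim_absorbing]). For Frechet spaces, P is the projection of a
    closed convex subset of X * Z, and the theorem of Robinson and Ursescu
    applies ([ursescu]), whose proof is that of the open mapping theorem: Baire,
    then successive approximation.

    All separation arguments go through the Mazur-Orlicz form of the
    Hahn-Banach theorem ([mazur_orlicz]), in which a sublinear functional and a
    convex set of affine constraints are treated together, and which follows
    from the linearity of minimal sublinear functionals. *)

(** * Sublinear functionals and the Mazur-Orlicz theorem *)

(** The two weights are separate variables because in the uses below they are
    quotients a / (a + b) and b / (a + b), for which 1 - a is inconvenient. *)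
Lemma convex_combE {R : realType} {V : lmodType R} (A : set (convex_lmodType V)) :
  convex_set A <-> forall (a b : R) (x y : V), 0 <= a -> 0 <= b -> a + b = 1 ->
    A x -> A y -> A (a *: x + b *: y).
Proof.
split=> [cA a b x y a0 b0 ab Ax Ay|cA x y l].
  have a1 : a <= 1 by rewrite -ab lerDl.
  have -> : b = 1 - a by rewrite -ab addrAC subrr add0r.
  exact: (set_mem (cA x y (Itv01 a0 a1) (mem_set Ax) (mem_set Ay))).
rewrite !inE => Ax Ay.
apply: (cA l%:num (1 - l%:num) x y _ _ _ Ax Ay); first exact: ge0.
  by rewrite subr_ge0.
by rewrite addrC subrK.
Qed.

Section sublinear.
Context {R : realType} {V : lmodType R}.
Implicit Types (p q : V -> R) (x y z : V).

Definition sublinear p :=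
  (forall x y, p (x + y) <= p x + p y) /\
  (forall t x, 0 < t -> p (t *: x) = t * p x).

Lemma sublinear0 p : sublinear p -> p 0 = 0.
Proof.
by move=> [_ /(_ 2 0)]; rewrite scaler0 => h; have := h (ltr0Sn _ _); lra.
Qed.

Lemma sublinearN p x : sublinear p -> - p (- x) <= p x.
Proof.
move=> sp; have := sp.1 x (- x); rewrite subrr (sublinear0 _ sp); lra.
Qed.

(** Gauges, lower bounds of chains of sublinear functionals and the functional
    of the next lemma are all infima of sets A x of this kind. Additivity is
    asked only up to a smaller element, which is what a chain provides. *)
Lemma sublinear_inf (A : V -> set R) :
  (forall x, A x !=set0) -> (forall x, has_lbound (A x)) ->
  (forall x y a b, A x a -> A y b -> exists2 c, A (x + y) c & c <= a + b) ->
  (forall t x a, 0 < t -> A x a -> A (t *: x) (t * a)) ->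
  sublinear (fun x => inf (A x)).
Proof.
move=> A0 Al AD AZ; split=> [x y|].
  rewrite -lerBlDr; apply: lb_le_inf => // a Aa.
  rewrite lerBlDl -lerBlDr; apply: lb_le_inf => // b Ab.
  have [c Ac cab] := AD _ _ _ _ Aa Ab.
  by rewrite lerBlDl; apply: le_trans cab; exact: ge_inf.
have leZ t x : 0 < t -> inf (A (t *: x)) <= t * inf (A x).
  move=> t0; rewrite -ler_pdivrMl//; apply: lb_le_inf => // a Aa.
  by rewrite ler_pdivrMl//; apply: ge_inf => //; exact: AZ.
move=> t x t0; apply/eqP; rewrite eq_le leZ//=.
have := leZ t^-1 (t *: x); rewrite invr_gt0 => /(_ t0).
by rewrite scalerA mulVf ?gt_eqF// scale1r ler_pdivlMl.
Qed.

(** The functional q x is the infimum of p (x + t *: d) + t * r over t >= 0 and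
    (d, r) in D. The hypothesis on D keeps this above - p (- x), convexity of D
    gives subadditivity, t = 0 gives q <= p, and t = 1 at x = - d gives the last
    clause. *)
Lemma sublinear_shift p (D : set (V * R^o)) : sublinear p -> D !=set0 ->
    convex_set (D : set (convex_lmodType (V * R^o)%type)) ->
    (forall d r, D (d, r) -> 0 <= p d + r) ->
  exists q, [/\ sublinear q, forall x, q x <= p x &
    forall d r, D (d, r) -> q (- d) <= r].
Proof.
move=> sp [[d0 r0] Dd0] /convex_combE cD Dp.
pose A x := [set a | exists (t : R) d r, [/\ 0 <= t, D (d, r) &
   a = p (x + t *: d) + t * r]].
have lA x : lbound (A x) (- p (- x)).
  move=> _ [t] [d] [r] [t0 Dd ->].
  have : 0 <= p (t *: d) + t * r.
    move: t0; rewrite le_eqVlt => /predU1P[<-|t0].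
      by rewrite scale0r (sublinear0 _ sp) mul0r addr0.
    by rewrite sp.2// -mulrDr mulr_ge0 ?Dp// ltW.
  have := sp.1 (x + t *: d) (- x); rewrite addrAC subrr add0r; lra.
have hlA x : has_lbound (A x) by exists (- p (- x)); exact: lA.
have Ap x : A x (p x).
  by exists 0, d0, r0; rewrite scale0r mul0r !addr0.
exists (fun x => inf (A x)); split.
- apply: sublinear_inf => //; first by move=> x; exists (p x).
  + move=> x y _ _ [t [d [r [t0 Dd ->]]]] [u [e [s [u0 De ->]]]].
    have [tu|tu] := eqVneq (t + u) 0.
      have [-> ->] : t = 0 /\ u = 0 by split; lra.
      exists (p (x + y)); first exact: Ap.
      by rewrite !scale0r !mul0r !addr0; exact: sp.1.
    have tu0 : 0 < t + u by rewrite lt_neqAle eq_sym tu addr_ge0.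
    have := cD (t / (t + u)) (u / (t + u)) _ _ _ _ _ Dd De.
    rewrite !divr_ge0 ?(ltW tu0)// -mulrDl divff//.
    move=> /(_ erefl erefl erefl) Dc.
    have mul_divK v : (t + u) * (v / (t + u)) = v by rewrite mulrC divfK.
    exists (p (x + y + (t *: d + u *: e)) + (t * r + u * s)).
      exists (t + u); eexists; eexists; split; [exact: ltW|exact: Dc|].
      congr (p (_ + _) + _).
        by rewrite /= scalerDr !scalerA !mul_divK.
      have -> : t * r + u * s = (t + u) * (t / (t + u) * r + u / (t + u) * s).
        by field.
      by [].
    by rewrite addrACA [leRHS]addrACA lerD2r; exact: sp.1.
  + move=> t x _ t0 [u [d [r [u0 Dd ->]]]].
    exists (t * u), d, r; split=> //; first by rewrite mulr_ge0// ltW.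
    by rewrite -scalerA -scalerDr sp.2// mulrDr mulrA.
- by move=> x; apply: ge_inf.
- move=> d r Dd; apply: ge_inf => //; exists 1, d, r; split => //.
  by rewrite scale1r addNr (sublinear0 _ sp) mul1r add0r.
Qed.

(** Zorn's lemma for the reversed pointwise order. The infimum of a chain below p
    is finite because every member q satisfies q x >= - q (- x) >= - p (- x). *)
Lemma minimal_sublinear p : sublinear p ->
  exists q, [/\ sublinear q, forall x, q x <= p x &
    forall q', sublinear q' -> (forall x, q' x <= q x) -> q' = q].
Proof.
move=> sp; pose P q := sublinear q /\ forall x, q x <= p x.
pose T := {q : V -> R | P q}.
pose r (s t : T) := `[< forall x, sval t x <= sval s x >].
have [|s t u /asboolP st /asboolP tu|s t /asboolP st /asboolP ts|B Bt|] :=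
    @Zorn T r.
- by move=> t; exact/asboolP.
- by apply/asboolP => x; exact: le_trans (tu x) (st x).
- case: s t st ts => [s Ps] [t Pt] /= st ts; apply: eq_exist.
  by apply/funext => x; apply/eqP; rewrite eq_le st ts.
- have [->|/set0P[b0 Bb0]] := eqVneq B set0.
    by exists (exist _ p (conj sp (fun x => lexx _))).
  pose A x := [set sval b x | b in B].
  have lA x : has_lbound (A x).
    exists (- p (- x)) => _ [[b [sb bp]] Bb <-] /=.
    by apply: le_trans (sublinearN _ x sb); rewrite lerN2.
  have A0 x : A x !=set0 by exists (sval b0 x), b0.
  have Pq : P (fun x => inf (A x)).
    split.
      apply: sublinear_inf => //.
        move=> x y _ _ [b Bb <-] [c Bc <-].
        have [/asboolP bc|/asboolP cb] := Bt _ _ Bb Bc.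
          exists (sval c (x + y)); first by exists c.
          by apply: le_trans ((svalP c).1.1 x y) _; rewrite lerD2r.
        exists (sval b (x + y)); first by exists b.
        by apply: le_trans ((svalP b).1.1 x y) _; rewrite lerD2l.
      move=> t x _ t0 [b Bb <-]; exists b => //.
      exact: (svalP b).1.2.
    move=> x; apply: le_trans ((svalP b0).2 x); apply: ge_inf => //.
    by exists b0.
  exists (exist _ _ Pq) => b Bb; apply/asboolP => x /=.
  by apply: ge_inf => //; exists b.
move=> [q [sq qp]] qmin; exists q; split => // q' sq' q'q.
have Pq' : P q' by split=> // x; exact: le_trans (q'q x) (qp x).
by have /(congr1 sval) := qmin (exist _ q' Pq') (asboolT q'q).
Qed.

(** Shifting q by the single constraint (x, - q x) gives a sublinear functional
    below q, hence equal to q by minimality, whose value at - x is at most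
    - q x. So q is odd, and an odd sublinear functional is linear. *)
Lemma minimal_sublinear_linear q : sublinear q ->
    (forall q', sublinear q' -> (forall x, q' x <= q x) -> q' = q) ->
  linear (q : V -> R^o).
Proof.
move=> sq qmin.
have qN x : q (- x) = - q x.
  have [|||q' [sq' q'q q'x]] := sublinear_shift q [set (x, - q x)] sq.
  - by exists (x, - q x).
  - apply/convex_combE => a b _ _ _ _ ab -> -> /=.
    by rewrite -scalerDl ab scale1r.
  - by move=> _ _ [-> ->]; rewrite subrr.
  apply/eqP; rewrite eq_le -{1}(qmin _ sq' q'q) (q'x x (- q x) erefl) /=.
  by rewrite lerNl sublinearN.
have qD x y : q (x + y) = q x + q y.
  apply/eqP; rewrite eq_le sq.1/=.
  have := sq.1 (x + y) (- y); rewrite addrK qN; lra.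
have qZ a x : q (a *: x) = a * q x.
  have [a0|a0|->] := ltrgt0P a; first exact: sq.2.
    by rewrite -[a in LHS]opprK scaleNr qN sq.2 ?oppr_gt0// mulNr opprK.
  by rewrite scale0r mul0r sublinear0.
by move=> a x y; rewrite qD qZ.
Qed.

(** Each (d, r) in D is an affine constraint f d + r >= 0. Allowing r to vary
    lets this single statement serve both for separating convex sets (constant
    r) and for finding subgradients of convex functions (D an epigraph). *)
Theorem mazur_orlicz p (D : set (V * R^o)) : sublinear p -> D !=set0 ->
    convex_set (D : set (convex_lmodType (V * R^o)%type)) ->
    (forall d r, D (d, r) -> 0 <= p d + r) ->
  exists f : V -> R^o, [/\ linear f, forall x, f x <= p x &
    forall d r, D (d, r) -> 0 <= f d + r].
Proof.
move=> sp D0 cD Dp.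
have [q [sq qp qD]] := sublinear_shift p D sp D0 cD Dp.
have [f [sf fq fmin]] := minimal_sublinear q sq.
exists f; split; first exact: minimal_sublinear_linear.
  by move=> x; exact: le_trans (fq x) (qp x).
move=> d r Dd; have := le_trans (fq (- d)) (qD _ _ Dd).
have := sublinearN f (- d) sf; rewrite opprK; lra.
Qed.

End sublinear.

(** * Functionals on locally convex spaces *)

Section continuity.
Context {R : realType} {T : topologicalType} {V : tvsType R}.

Lemma continuous_addf (f g : T -> V) : continuous f -> continuous g ->
  continuous (fun x => f x + g x).
Proof.
move=> cf cg x.
apply: (@continuous_comp _ _ _ (fun x => (f x, g x)) (fun p => p.1 + p.2));
  last exact: add_continuous.
by apply: cvg_pair; [exact: cf|exact: cg].
Qed.

Lemma continuous_scalef (f : T -> R^o) (g : T -> V) : continuous f ->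
  continuous g -> continuous (fun x => f x *: g x).
Proof.
move=> cf cg x.
apply: (@continuous_comp T (R^o * V)%type V (fun x => (f x : R^o, g x))
  (fun p => p.1 *: p.2)); last exact: scale_continuous.
by apply: (@cvg_pair _ _ _ _ (nbhs (f x : R^o))); [exact: cf|exact: cg].
Qed.

End continuity.

Section tvs.
Context {R : realType} {V : tvsType R}.
Implicit Types (x y z : V) (W : set V).

Lemma continuous_affine (c : R) (v : V) : continuous (fun x : V => c *: x + v).
Proof.
apply: continuous_addf; last by move=> x; exact: cst_continuous.
by apply: continuous_scalef => x; [exact: cst_continuous|exact: cvg_id].
Qed.

Lemma nbhs_affine W (c : R) x v : nbhs (c *: x + v) W ->
  nbhs x [set y | W (c *: y + v)].
Proof. exact: continuous_affine. Qed.

Lemma nbhs0_absorbing W x : nbhs 0 W ->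
  exists2 e : R, 0 < e & forall t, `|t| < e -> W (t *: x).
Proof.
rewrite -(scale0r x) => W0.
have [[A B] /= [/nbhs_ballP[e /= e0 eA] xB] AB] :=
  @scale_continuous R V (0, x) W W0.
exists e => // t te; apply: (AB (t, x)); split => /=; last exact: nbhs_singleton.
by apply: eA; rewrite -ball_normE/= sub0r normrN.
Qed.

Lemma convex_nbhs0 W : nbhs 0 W -> exists W', [/\ nbhs 0 W', W' `<=` W &
  convex_set (W' : set (convex_lmodType V))].
Proof.
move=> W0; have [B cB [Bo Bb]] := @locally_convex R V.
have [W' [BW' W'0] W'W] := Bb 0 W W0; exists W'; split => //.
  by apply: open_nbhs_nbhs; split => //; exact: Bo.
exact/cB/mem_set.
Qed.

(** A one-sided bound is enough: applied to both (y - x) / c and (x - y) / c in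
    W, it bounds |f y - f x| by c * M. *)
Lemma bounded_above_continuous (f : {linear V -> R^o}) W (M : R) :
  nbhs 0 W -> (forall w, W w -> f w <= M) -> continuous f.
Proof.
move=> W0 fM x.
have M0 : 0 <= M by rewrite -(linear0 f); apply: fM; exact: nbhs_singleton.
apply/cvgrPdist_lt => e e0.
(* M + 1 rather than M, as M may vanish. *)
pose c : R := e / (M + 1).
have c0 : 0 < c by rewrite divr_gt0// ltr_wpDl.
have cM : c * M < e.
  rewrite /c mulrAC ltr_pdivrMr; last by rewrite ltr_wpDl.
  by rewrite ltr_pM2l// ltrDl.
have W1 : nbhs x [set y | W (c^-1 *: y + - c^-1 *: x)].
  by apply: nbhs_affine; rewrite scaleNr subrr.
have W2 : nbhs x [set y | W (- c^-1 *: y + c^-1 *: x)].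
  by apply: nbhs_affine; rewrite scaleNr addNr.
apply: filterS (filterI W1 W2) => y [/= /fM + /fM].
rewrite !linearD !linearZ_LR /= => h1 h2.
have {}h1 : c^-1 * (f y - f x) <= M by move: h1; rewrite /GRing.scale/=; lra.
have {}h2 : c^-1 * (f x - f y) <= M by move: h2; rewrite /GRing.scale/=; lra.
move: h1 h2; rewrite !ler_pdivrMl// => h1 h2.
by rewrite ltr_norml; apply/andP; split; lra.
Qed.

Lemma contlin_pack (U : tvsType R) (f : V -> U) : linear f -> continuous f ->
  exists F : contlin V U, F = f :> (V -> U).
Proof.
move=> lf cf.
pose F : {linear V -> U} := HB.pack f (GRing.isLinear.Build R V U *:%R f lf).
by exists (@ContLin R V U F cf).
Qed.

Definition gauge W x : R := inf [set c : R | 0 < c /\ W (c^-1 *: x)].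

Lemma gauge_lbound W x : lbound [set c : R | 0 < c /\ W (c^-1 *: x)] 0.
Proof. by move=> c [/ltW]. Qed.

Lemma gauge_nonempty W x : nbhs 0 W ->
  [set c : R | 0 < c /\ W (c^-1 *: x)] !=set0.
Proof.
move=> W0; have [e e0 eW] := nbhs0_absorbing W x W0.
exists (e / 2)^-1; split; first by rewrite invr_gt0 divr_gt0.
by rewrite invrK; apply: eW; rewrite gtr0_norm; lra.
Qed.

Lemma sublinear_gauge W : nbhs 0 W ->
  convex_set (W : set (convex_lmodType V)) -> sublinear (gauge W).
Proof.
move=> W0 /convex_combE cW; apply: sublinear_inf => [x|x|x y a b [a0 Wa] [b0 Wb]|].
- exact: gauge_nonempty.
- by exists 0; exact: gauge_lbound.
- exists (a + b) => //; split; first by rewrite addr_gt0.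
  have ab : a + b != 0 by rewrite gt_eqF// addr_gt0.
  have -> : (a + b)^-1 *: (x + y) =
      (a / (a + b)) *: (a^-1 *: x) + (b / (a + b)) *: (b^-1 *: y).
    rewrite !scalerA scalerDr; congr (_ *: _ + _ *: _).
      by field; rewrite ab gt_eqF.
    by field; rewrite ab gt_eqF.
  apply: cW => //; rewrite ?divr_ge0 ?addr_ge0 ?(ltW a0) ?(ltW b0)//.
  by rewrite -mulrDl divff.
- move=> t x a t0 [a0 Wa]; split; first by rewrite mulr_gt0.
  by rewrite scalerA invfM mulrAC mulVf ?gt_eqF// mul1r.
Qed.

(** This is [mazur_orlicz] for M times the gauge of W: the hypothesis on D says
    exactly that M * gauge W d + r >= 0, and a linear functional below
    M * gauge W is at most M on W, hence continuous. *)
Lemma gauge_support W (D : set (V * R^o)) (M : R) : nbhs 0 W ->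
    convex_set (W : set (convex_lmodType V)) -> 0 < M -> D !=set0 ->
    convex_set (D : set (convex_lmodType (V * R^o)%type)) ->
    (forall d r c, D (d, r) -> 0 < c -> W (c^-1 *: d) -> 0 <= M * c + r) ->
  exists f : contlin V R^o, (forall w, W w -> f w <= M) /\
    forall d r, D (d, r) -> 0 <= f d + r.
Proof.
move=> W0 cW M0 D0 cD DM.
have sg := sublinear_gauge W W0 cW.
have sp : sublinear (fun x => M * gauge W x).
  split=> [x y|t x t0]; first by rewrite -mulrDr ler_pM2l// sg.1.
  by rewrite sg.2// mulrCA.
have [|f [lf fp fD]] := mazur_orlicz _ D sp D0 cD.
  move=> d r Dd; rewrite -lerBlDr sub0r -ler_pdivrMl//.
  apply: lb_le_inf; first exact: gauge_nonempty.
  by move=> c [c0 Wc]; rewrite ler_pdivrMl// -subr_ge0 opprK; exact: DM Dd _ _.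
have fM w : W w -> f w <= M.
  move=> Ww; apply: le_trans (fp w) _; rewrite ger_pMr//.
  apply: ge_inf; first by exists 0; exact: gauge_lbound.
  by split; rewrite ?ltr01// invr1 scale1r.
pose F : {linear V -> R^o} := HB.pack f (GRing.isLinear.Build R V R^o *:%R f lf).
have cf : continuous F by apply: (@bounded_above_continuous _ W M).
by exists (@ContLin R V R^o F cf).
Qed.

(** Choose a convex neighborhood W of 0 that misses x. Then x in c W forces
    c >= 1, so the constraint f x >= 1 is compatible with the gauge of W. *)
Lemma point_support x : hausdorff_space V -> x != 0 ->
  exists f : contlin V R^o, f x = 1.
Proof.
move=> hV x0.
have [W [W0 Wx cW]] : exists W, [/\ nbhs 0 W, ~ W x &
    convex_set (W : set (convex_lmodType V))].
  have [W [W0 WU cW]] : exists W', [/\ nbhs 0 W', W' `<=` ~` [set x] &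
      convex_set (W' : set (convex_lmodType V))].
    apply: convex_nbhs0; apply: open_nbhs_nbhs; split; last first.
      by move=> /esym/eqP; exact/negP.
    rewrite openC; apply: accessible_closed_set1; exact: hausdorff_accessible.
  by exists W; split => // /WU; exact.
have [||d r c [-> ->] c0 Wc|f [_ fD]] :=
    @gauge_support W [set (x, -1 : R^o)] 1 W0 cW ltr01.
- by exists (x, -1).
- apply/convex_combE => a b _ _ _ _ ab -> ->.
  by rewrite -scalerDl ab scale1r.
- rewrite mul1r subr_ge0 leNgt; apply/negP => c1; apply: Wx.
  move/convex_combE: cW => /(_ c (1 - c) (c^-1 *: x) 0).
  rewrite scalerA divff ?gt_eqF// scale1r scaler0 addr0; apply => //.
  + exact: ltW.
  + by rewrite subr_ge0 ltW.
  + by rewrite addrC subrK.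
  + exact: nbhs_singleton.
have fx : 0 < f x by have := fD x (-1) erefl; rewrite subr_ge0; exact: lt_le_trans.
have [||g gE] := @contlin_pack R^o (fun y => (f x)^-1 * f y).
- move=> a y z; rewrite linearP /= mulrDr; congr (_ + _).
  by rewrite /GRing.scale/= mulrCA.
- move=> y; apply: (@continuous_comp _ _ _ f (fun t : R^o => (f x)^-1 * t)).
    exact: contlin_continuous.
  exact: mulrl_continuous.
by exists g; rewrite gE mulVf// gt_eqF.
Qed.

End tvs.

(** * Absorbing convex sets in finite dimension *)

Section subspaces.
Context {R : realType} {V : tvsType R}.
Implicit Types (x y z : V) (L A W : set V).

Lemma linear_subspaceE L : linear_subspace L <->
  L 0 /\ forall (a : R) x y, L x -> L y -> L (a *: x + y).
Proof.
split=> [[L0 LP]|[L0 LP]].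
  split; first by move: L0; rewrite inE.
  by move=> a x y Lx Ly; have := LP a x y; rewrite !inE; exact.
split; first by rewrite inE.
by move=> a x y; rewrite !inE; exact: LP.
Qed.

Lemma linear_subspace0 L : linear_subspace L -> L 0.
Proof. by move=> /linear_subspaceE[]. Qed.

Lemma linear_subspaceZ L a x : linear_subspace L -> L x -> L (a *: x).
Proof. by move=> /linear_subspaceE[L0 LP] Lx; rewrite -[_ *: x]addr0; exact: LP. Qed.

Lemma linear_subspaceD L x y : linear_subspace L -> L x -> L y -> L (x + y).
Proof. by move=> /linear_subspaceE[L0 LP] Lx Ly; rewrite -[x]scale1r; exact: LP. Qed.

Lemma lin_subspace (U : set V) : linear_subspace (lin U).
Proof.
apply/linear_subspaceE; split=> [|a x y Ux Uy] M
  [/[dup] /linear_subspaceE[M0 MP] sM UM] //.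
by apply: MP; [apply: Ux|apply: Uy].
Qed.

Definition absorbing L A := forall z, L z -> exists2 t : R, 0 < t & A (t *: z).

Lemma absorbing_segment L A z : linear_subspace L -> absorbing L A ->
    convex_set (A : set (convex_lmodType V)) -> L z ->
  exists2 t : R, 0 < t & forall a, `|a| <= t -> A (a *: z).
Proof.
move=> sL LA /convex_combE cA Lz.
have A0 : A 0.
  have [t _] := LA 0 (linear_subspace0 L sL).
  by rewrite scaler0.
have LNz : L (- z) by rewrite -scaleN1r; exact: linear_subspaceZ.
have pos y s a : 0 < s -> A (s *: y) -> 0 <= a <= s -> A (a *: y).
  move=> s0 Asy /andP[a0 as_].
  have -> : a *: y = (a / s) *: (s *: y) + (1 - a / s) *: 0.
    by rewrite scaler0 addr0 scalerA divfK// gt_eqF.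
  apply: cA => //; first by rewrite divr_ge0// ltW.
    by rewrite subr_ge0 ler_pdivrMr// mul1r.
  by rewrite addrC subrK.
have [t t0 At] := LA z Lz; have [s s0 As] := LA _ LNz.
exists (Num.min t s); first by rewrite lt_min t0.
move=> a; rewrite le_min => /andP[at_ as_].
have [a0|a0] := leP 0 a.
  by apply: (pos _ t) => //; rewrite a0 -(ger0_norm a0).
rewrite -[a]opprK scaleNr -scalerN.
by apply: (pos _ s) => //; rewrite oppr_ge0 (ltW a0)/= -(ltr0_norm a0).
Qed.

(** Induction on s. If pi serves for s and e' := e - pi e is not 0, a continuous g
    with g e' = 1 exists, V being Hausdorff, and
    z |-> pi z + g (z - pi z) *: e' fixes e and still fixes the elements of s.
    The last clause passes to the new map because the latter is the midpoint
    of 2 *: pi z and (2 * g (z - pi z)) *: e', each of which is in A for z near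
    0. This clause replaces the uniqueness of the Hausdorff vector topology
    in finite dimension. *)
Lemma finite_projection L (s : seq V) : hausdorff_space V -> linear_subspace L ->
    (forall z, z \in s -> L z) ->
  exists pi : {linear V -> V}, [/\ continuous pi, forall z, L (pi z),
    forall z, z \in s -> pi z = z &
    forall A, convex_set (A : set (convex_lmodType V)) -> absorbing L A ->
      nbhs 0 (pi @^-1` A)].
Proof.
move=> hV sL; elim: s => [_|e s IH Les].
  exists \0; split => //.
  - by move=> x; exact: cst_continuous.
  - by move=> z; exact: linear_subspace0 L sL.
  - move=> A _ /(_ 0)[|t _]; first exact: linear_subspace0 L sL.
    rewrite scaler0 => A0; apply: filterE => z /=; exact: A0.
have [|p [cp Lp ps pA]] := IH; first by move=> z zs; apply: Les; rewrite inE zs orbT.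
have Le : L e by apply: Les; rewrite mem_head.
pose e' := e - p e.
have Le' : L e'.
  by apply: linear_subspaceD => //; rewrite -scaleN1r; exact: linear_subspaceZ.
have [e'0|e'0] := eqVneq e' 0.
  exists p; split => // z; rewrite inE => /predU1P[->|]; last exact: ps.
  by apply/eqP; rewrite eq_sym -subr_eq0; exact/eqP.
have [g ge'] := point_support e' hV e'0.
have pe' : forall z, z \in s -> g (z - p z) = 0.
  by move=> z zs; rewrite ps// subrr linear0.
pose h z := g (z - p z).
have ch : continuous (h : V -> R^o).
  move=> z; apply: (@continuous_comp _ _ _ (fun z => z - p z) g);
    last exact: contlin_continuous.
  apply: continuous_addf; first by move=> ?; exact: cvg_id.
  move=> y; apply: (@continuous_comp _ _ _ p -%R); first exact: cp.
  exact: opp_continuous.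
have lp' : linear (fun z => p z + h z *: e').
  move=> a x y; rewrite /h.
  have -> : a *: x + y - p (a *: x + y) = a *: (x - p x) + (y - p y).
    by rewrite linearP/= scalerBr addrACA opprD.
  by rewrite !linearP /= scalerDl [a *: (p x + _)]scalerDr addrACA scalerA.
have [P PE] : exists P : {linear V -> V}, P = (fun z => p z + h z *: e') :> (V -> V).
  by exists (HB.pack_for {linear V -> V} (fun z => p z + h z *: e')
    (GRing.isLinear.Build R V V *:%R (fun z => p z + h z *: e') lp')).
exists P; split.
- rewrite PE; apply: continuous_addf; first exact: cp.
  apply: continuous_scalef; first exact: ch.
  by move=> x; exact: cst_continuous.
- move=> z; rewrite PE; apply: linear_subspaceD => //.
  exact: linear_subspaceZ.
- move=> z; rewrite PE inE => /predU1P[->|zs].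
    by rewrite /h ge' scale1r addrC subrK.
  by rewrite ps// /h pe'// scale0r addr0.
- move=> A cA LA.
  have [t t0 At] := absorbing_segment _ _ _ sL LA cA Le'.
  have A2 : nbhs 0 (p @^-1` [set z | A (2 *: z)]).
    apply: pA.
      apply/convex_combE => a b x y a0 b0 ab Ax Ay /=.
      rewrite scalerDr scalerA mulrC -scalerA [2 *: (b *: y)]scalerA mulrC -scalerA.
      by move/convex_combE : cA; apply.
    move=> z Lz; have [r r0 Ar] := LA z Lz; exists (r / 2); first exact: divr_gt0.
    by rewrite /= scalerA mulrC divfK.
  have h0 : h 0 = 0 by rewrite /h (linear0 p) subr0 linear0.
  have ht : nbhs 0 [set z | `|h z| < t / 2].
    have := ch 0; rewrite /continuous_at h0 => /cvgr0Pnorm_lt; apply.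
    exact: divr_gt0.
  rewrite PE; apply: filterS (filterI A2 ht) => z [/= Az hz].
  have -> : p z + h z *: e' = 2^-1 *: (2 *: p z) + 2^-1 *: ((2 * h z) *: e').
    by rewrite !scalerA mulrA mulVf// scale1r mul1r.
  move/convex_combE : cA; apply => //.
  + by rewrite -mulr2n -[_ *+ _]mulr_natr mulVf.
  + by apply: At; rewrite normrM ger0_norm//; lra.
Qed.

(** On L the map pi of [finite_projection] is the identity, so the preimage of A
    under pi is a neighborhood of 0 whose trace on L is contained in A. *)
Lemma finite_dim_absorbing L A : hausdorff_space V -> linear_subspace L ->
    finite_dim L -> convex_set (A : set (convex_lmodType V)) ->
    absorbing L A ->
  exists2 W, nbhs 0 W & W `&` L `<=` A.
Proof.
move=> hV sL [n [e Le]] cA LA.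
have [z|p [_ _ pe pA]] := finite_projection L [seq e i | i <- enum 'I_n] hV sL.
  move=> /mapP[i _ ->]; rewrite Le => M [_]; apply.
  by exists i.
exists (p @^-1` A); first exact: pA.
move=> z [/= Apz]; rewrite Le => /(_ [set z | p z = z]) <- //.
split.
  apply/linear_subspaceE; split; first exact: linear0.
  by move=> a x y /= px py; rewrite linearP/= px py.
move=> _ [i _ <-] /=; apply: pe; apply: map_f; exact: mem_enum.
Qed.

End subspaces.

(** * Baire category and the Robinson-Ursescu theorem *)

Section complete_metric.
Context {R : realType} {V : tvsType R}.

(** What [frechet] requires of its witness, so that frechet V is convertible to
    exists d, frechet_metric d. *)
Definition frechet_metric (d : V -> V -> R) :=
  [/\ [/\ forall x y, d x y = 0 <-> x = y,
          forall x y, d x y = d y x,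
          forall x y z, d x z <= d x y + d y z
        & forall x y z, d (x + z) (y + z) = d x y],
      forall x, nbhs x = filter_from [set e : R | 0 < e]
                           (fun e => [set y | d x y < e])
    & forall u : nat -> V,
        (forall e : R, 0 < e ->
           exists N, forall m n, (N <= m)%N -> (N <= n)%N ->
             d (u m) (u n) < e) ->
        exists l : V, u @ \oo --> l].

Context (d : V -> V -> R) (dP : frechet_metric d).

Lemma metric_nbhs x (e : R) : 0 < e -> nbhs x [set y | d x y < e].
Proof. by case: dP => _ nd _ e0; rewrite nd; exists e. Qed.

Lemma metric_cvg (u : nat -> V) l (e : R) : u @ \oo --> l -> 0 < e ->
  exists N, forall n, (N <= n)%N -> d (u n) l < e.
Proof.
case: (dP) => [[_ ds _ _] _ _] ul e0.
have [N _ uN] := ul _ (metric_nbhs l e e0).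
by exists N => n Nn; rewrite ds; exact: uN.
Qed.

(** Bounding the steps by the decrements of a null sequence gives convergence
    together with the rate. The rate is what keeps a limit inside nested balls
    of radii a n; with a n = 2 / 2 ^ n the lemma covers series with
    geometrically small terms. *)
Lemma metric_telescope (u : nat -> V) (a : nat -> R) :
    (forall n, d (u n) (u n.+1) <= a n - a n.+1) -> (forall n, 0 <= a n) ->
    a @ \oo --> (0 : R) ->
  exists2 l, u @ \oo --> l & forall n, d (u n) l <= a n.
Proof.
case: (dP) => [[d0 ds dt _] _ dc] ua age0 a0.
have uk n k : d (u n) (u (n + k)%N) <= a n - a (n + k)%N.
  elim: k => [|k IH]; first by rewrite addn0 subrr (d0 _ _).2.
  rewrite addnS; apply: le_trans (dt _ (u (n + k)%N) _) _.
  by have := ua (n + k)%N; lra.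
have dge0 x y : 0 <= d x y.
  have := dt x y x; rewrite (ds y x) (d0 x x).2//; lra.
have ale m n : (m <= n)%N -> a n <= a m.
  move=> /subnKC <-; have := uk m (n - m)%N.
  have := dge0 (u m) (u (m + (n - m))%N); lra.
have uN N k : (N <= k)%N -> d (u N) (u k) <= a N.
  move=> /subnKC <-; apply: le_trans (uk N (k - N)%N) _.
  by rewrite lerBlDr lerDl.
have [e e0|l ul] := dc u.
  have [N _ aN] : \forall n \near \oo, `|a n| < e / 2.
    by apply: cvgr0_norm_lt; rewrite ?divr_gt0.
  exists N => m n Nm Nn; apply: le_lt_trans (dt _ (u N) _) _; rewrite (ds (u m)).
  have := aN N (leqnn N); rewrite /= ger0_norm//.
  by have := uN _ _ Nm; have := uN _ _ Nn; lra.
exists l => // n; apply/ler_addgt0Pr => e e0.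
have [N Nu] := metric_cvg u l e ul e0.
apply: le_trans (dt _ (u (maxn n N)) _) _.
by rewrite lerD// ?uN ?leq_maxl// ltW// Nu// leq_maxr.
Qed.

(** If no A n contained a ball relative to L, one could choose nested closed
    balls centered in L, the n-th avoiding A n, with radii tending to 0. Their
    centers converge to a point of L that is in no A n. *)
Lemma baire_closed_cover (L : set V) (A : nat -> set V) :
    L !=set0 -> closed L -> (forall n, closed (A n)) ->
    (forall z, L z -> exists n, A n z) ->
  exists n z, exists2 e : R, 0 < e & L z /\ forall y, L y -> d z y < e -> A n y.
Proof.
case: (dP) => [[d0 ds dt _] nd _] [z0 Lz0] cL cA LA; apply: contrapT => nA.
(* From the n-th center and radius to the next; the third clause nests the
   closed balls. *)
have step (s : nat * (V * R)) : exists t : V * R,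
    L s.2.1 -> 0 < s.2.2 ->
    [/\ L t.1, 0 < t.2, d s.2.1 t.1 <= s.2.2 - t.2, t.2 <= s.2.2 / 2 &
      forall w, d t.1 w <= t.2 -> ~ A s.1 w].
  case: s => n [z e] /=.
  have [[Lz e0]|h] := pselect (L z /\ 0 < e); last first.
    by exists (z, e) => Lz e0; exfalso; apply: h.
  have [y [Ly zy nAy]] : exists y, [/\ L y, d z y < e / 2 & ~ A n y].
    apply: contrapT => h; apply: nA; exists n, z, (e / 2); first exact: divr_gt0.
    by split => // y Ly zy; apply: contrapT => nAy; apply: h; exists y.
  have : nbhs y (~` A n) by apply: open_nbhs_nbhs; split => //; exact: closed_openC.
  rewrite nd => -[r /= r0 yr].
  have [r2 r2E] : exists r2, r2 = Num.min (r / 2) (e / 2) by eexists.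
  have : r2 <= r / 2 by rewrite r2E ge_min lexx.
  have : r2 <= e / 2 by rewrite r2E ge_min lexx orbT.
  have r20 : 0 < r2 by rewrite r2E lt_min !divr_gt0.
  exists (y, r2) => _ _ /=; split => //; first lra.
  by move=> w yw; apply: yr => /=; lra.
have [g gP] := choice step.
pose fix s n := if n is m.+1 then g (m, s m) else (z0, 1 : R).
have sP n : L (s n).1 /\ 0 < (s n).2.
  by elim: n => [//|n [Ln n0]] /=; have [] := gP (n, s n) Ln n0.
have eP n : (s n).2 <= 2^-1 ^+ n.
  elim: n => [//|n IH] /=; have [Ln n0] := sP n.
  have [_ _ _ h _] := gP (n, s n) Ln n0.
  by apply: le_trans h _; rewrite exprSr ler_pM2r.
have [|||l ul dl] := metric_telescope (fun n => (s n).1) (fun n => (s n).2).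
- by move=> n; have [Ln n0] := sP n; have [] := gP (n, s n) Ln n0.
- by move=> n; apply: ltW; exact: (sP n).2.
- apply: (@squeeze_cvgr _ _ _ _ (fun=> 0) (fun n => 2^-1 ^+ n)).
  + by apply: nearW => n; rewrite eP andbT ltW//; exact: (sP n).2.
  + exact: cvg_cst.
  + by apply: cvg_expr; rewrite ger0_norm; lra.
have Ll : L l.
  apply: (closed_cvg L cL _ _ ul); apply: nearW => n; exact: (sP n).1.
have [n Anl] := LA l Ll.
have [Ln n0] := sP n; have [_ _ _ _ h] := gP (n, s n) Ln n0.
exact: (h l (dl n.+1)).
Qed.

End complete_metric.

Lemma convex_closure {R : realType} {V : tvsType R} (A : set V) :
  convex_set (A : set (convex_lmodType V)) ->
  convex_set (closure A : set (convex_lmodType V)).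
Proof.
move=> /convex_combE cA; apply/convex_combE => a b x y a0 b0 ab Ax Ay B.
have cf : continuous (fun p : V * V => a *: p.1 + b *: p.2).
  apply: continuous_addf; apply: continuous_scalef; by [
    move=> ?; exact: cst_continuous|move=> ?; exact: cvg_fst|
    move=> ?; exact: cvg_snd].
move=> /(cf (x, y))[[B1 B2] /= [/Ax[u [Au B1u]] /Ay[v [Av B2v]]] BB].
by exists (a *: u + b *: v); split; [exact: cA|exact: (BB (u, v))].
Qed.

Section ursescu.
Context {R : realType} {X Z : tvsType R}.
Context (Gam : set (X * Z)) (L : set Z).
Context (cGam : convex_set (Gam : set (convex_lmodType (X * Z)%type))).
Context (Gam0 : Gam (0, 0)).
Context (sL : linear_subspace L).
Context (LG : forall p, Gam p -> L p.2).
Context (closedL : closed L).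
Context (LGam : absorbing L [set z | exists x, Gam (x, z)]).

Let img (U : set X) : set Z := [set z | exists2 x, U x & Gam (x, z)].

Let Gam_star (s : R) x z : 0 <= s -> s <= 1 -> Gam (x, z) -> Gam (s *: x, s *: z).
Proof.
move=> s0 s1 xz; move/convex_combE : cGam => /(_ s (1 - s) (x, z) 0 s0).
rewrite scaler0 addr0 subr_ge0; apply => //; by rewrite addrC subrK.
Qed.

(** Let D be the closure of img U' for a convex U' in U. The multiples of D
    cover L, so by Baire D contains a neighborhood, relative to L, of a multiple
    of some z in L. A negative multiple of z is in D as well, and
    averaging the two moves this neighborhood to 0. *)
Lemma almost_open (d : Z -> Z -> R) (U : set X) : frechet_metric d -> nbhs 0 U ->
  exists2 N, nbhs 0 N & N `&` L `<=` closure (img U).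
Proof.
move=> dP /convex_nbhs0[U' [U'0 U'U /convex_combE cU']].
pose D := closure (img U').
have DU : D `<=` closure (img U).
  by apply: closureS => z [x /U'U Ux xz]; exists x.
move/convex_combE : cGam => cG.
have /convex_combE cD : convex_set (D : set (convex_lmodType Z)).
  apply: convex_closure; apply/convex_combE => a b z w a0 b0 ab [x Ux xz] [y Uy yw].
  exists (a *: x + b *: y); first exact: cU'.
  exact: (cG a b (x, z) (y, w)).
have cover z : L z -> exists n, D (n.+1%:R^-1 *: z).
  move=> Lz; have [t t0 [x xz]] := LGam z Lz.
  have [e e0 eU] := nbhs0_absorbing U' x U'0.
  have r0 : 0 < t * Num.min e 1 by rewrite mulr_gt0// lt_min e0 ltr01.
  have [n _ nr] := near_infty_natSinv_lt (PosNum r0).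
  have {nr} := nr n (leqnn n); rewrite /= => nr.
  exists n; apply: subset_closure.
  pose s := t^-1 * n.+1%:R^-1.
  have s0 : 0 < s by rewrite mulr_gt0 ?invr_gt0.
  have : s < Num.min e 1 by rewrite /s ltr_pdivrMl.
  rewrite lt_min => /andP[se s1].
  exists (s *: x); first by apply: eU; rewrite gtr0_norm.
  have -> : n.+1%:R^-1 *: z = s *: (t *: z).
    by rewrite scalerA /s mulrAC mulVf ?gt_eqF// mul1r.
  exact: Gam_star (ltW s0) (ltW s1) xz.
have [n [z [e e0 [Lz zD]]]] : exists n z, exists2 e : R, 0 < e &
    L z /\ forall y, L y -> d z y < e -> D (n.+1%:R^-1 *: y).
  apply: (baire_closed_cover d dP L (fun n => [set y | D (n.+1%:R^-1 *: y)])) => //.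
    by exists 0; exact: linear_subspace0.
  move=> n; apply: (@preimage_closed _ _ (fun y : Z => n.+1%:R^-1 *: y) D).
    move=> y _; have := continuous_affine n.+1%:R^-1 0 y.
    by under eq_fun do rewrite addr0.
  exact: closed_closure.
have [m Dm] : exists m, D (m.+1%:R^-1 *: - z).
  by apply: cover; rewrite -scaleN1r; exact: linear_subspaceZ.
(* The weights b * n.+1 and b * m.+1 sum to 1 and make the two multiples of z
   cancel. *)
pose b : R := (n.+1 + m.+1)%:R^-1.
have b0 : b != 0 by rewrite invr_neq0// pnatr_eq0.
exists ( *:%R b @` [set w | d 0 w < e]).
  by apply: nbhs0Z => //; exact: metric_nbhs.
move=> _ [[w /= w0 <-] Lw]; apply: DU.
have {}Lw : L w.
  by rewrite -[w]scale1r -(mulVf b0) -scalerA; exact: linear_subspaceZ.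
have -> : b *: w = (b * n.+1%:R) *: (n.+1%:R^-1 *: (z + w)) +
    (b * m.+1%:R) *: (m.+1%:R^-1 *: - z).
  by rewrite !scalerA !mulfK ?pnatr_eq0// -scalerDr addrAC subrr add0r.
have bge0 : 0 <= b by rewrite invr_ge0.
apply: cD => //; rewrite ?mulr_ge0//.
  by rewrite -mulrDr -natrD mulVf// pnatr_eq0.
apply: zD; first exact: linear_subspaceD.
case: (dP) => [[_ _ _ di] _ _].
by rewrite -[X in d X _]add0r [X in d _ X]addrC di.
Qed.

(** Given w in L near 0, choose (x_i, z_i) in Gam with w the sum of the
    z_i / 2 ^ (i + 1), where x_i is so small that the sum x of the
    x_i / 2 ^ (i + 1) converges. The weights sum to 1, so (x, w) is a limit of
    convex combinations of points of Gam and of (0, 0), and Gam is closed. Each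
    z_i is found because the closure of img (U i) contains a neighborhood of 0
    in L ([almost_open]). *)
Lemma ursescu0 : closed Gam -> frechet X -> frechet Z ->
  exists2 W, nbhs 0 W & W `&` L `<=` [set z | exists x, Gam (x, z)].
Proof.
move=> clG [dX dXP] [dZ dZP].
pose h k : R := 2^-1 ^+ k.
have h0 k : 0 < h k by rewrite exprn_gt0.
have [dX0 dXs dXt dXi] := let: And3 a _ _ := dXP in a.
have [dZ0 dZs dZt dZi] := let: And3 a _ _ := dZP in a.
pose U k := [set x | dX 0 (h k.+1 *: x) < h k].
have U0 k : nbhs 0 (U k).
  have := nbhs_affine [set x | dX 0 x < h k] (h k.+1) 0 0.
  rewrite scaler0 addr0 => /(_ (metric_nbhs dX dXP 0 _ (h0 k))).
  by apply: filterS => x /=; rewrite addr0.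
have /choice[N NP] k : exists N, [/\ nbhs 0 N, N `&` L `<=` closure (img (U k)) &
    forall z, N z -> dZ 0 (h k.+1 *: z) < h k].
  have [N N0 NU] := almost_open dZ (U k) dZP (U0 k).
  exists (N `&` [set z | dZ 0 (h k.+1 *: z) < h k]); split.
  - apply: filterI => //.
    have := nbhs_affine [set x | dZ 0 x < h k] (h k.+1) 0 0.
    rewrite scaler0 addr0 => /(_ (metric_nbhs dZ dZP 0 _ (h0 k))).
    by apply: filterS => x /=; rewrite addr0.
  - by move=> z [[Nz _] Lz]; exact: NU.
  - by move=> z [].
(* The state v k is 2 ^ (k + 1) times the remainder left after k terms; it has
   to remain in N k so that it can be approximated from U k. *)
have step (s : nat * Z) : exists p : X * Z, N s.1 s.2 -> L s.2 ->
    [/\ U s.1 p.1, Gam p, N s.1.+1 (2 *: (s.2 - p.2)) & L (2 *: (s.2 - p.2))].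
  case: s => k v /=; have [[Nv Lv]|] := pselect (N k v /\ L v); last first.
    by move=> h'; exists 0 => Nv Lv; exfalso; exact: h'.
  have [_ Ncl _] := NP k; have [N1 _ _] := NP k.+1.
  have : nbhs v [set y | N k.+1 (- 2 *: y + 2 *: v)].
    by apply: nbhs_affine; rewrite scaleNr addNr.
  move=> /(Ncl v (conj Nv Lv))[z [[x Ux xz] Nz]].
  have Lz : L z by apply: (LG (x, z)).
  exists (x, z) => _ _; split => //=.
    by rewrite scalerBr addrC -scaleNr.
  apply: linear_subspaceZ => //; apply: linear_subspaceD => //.
  by rewrite -scaleN1r; exact: linear_subspaceZ.
have [g gP] := choice step.
exists [set w | N 0%N (2 *: w)].
  have [N0 _ _] := NP 0%N.
  have := nbhs_affine (N 0%N) 2 0 0; rewrite scaler0 addr0 => /(_ N0).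
  by apply: filterS => x /=; rewrite addr0.
move=> w [/= Nw Lw].
pose fix v k := if k is m.+1 then 2 *: (v m - (g (m, v m)).2) else 2 *: w.
have vP k : N k (v k) /\ L (v k).
  elim: k => [|k [Nk Lk]] /=; first by split => //; exact: linear_subspaceZ.
  by have [] := gP (k, v k) Nk Lk.
pose xs k := \sum_(i < k) h i.+1 *: (g (i : nat, v i)).1.
pose zs k := \sum_(i < k) h i.+1 *: (g (i : nat, v i)).2.
have zsE k : zs k = w - h k.+1 *: v k.
  elim: k => [|k IH].
    by rewrite /zs big_ord0 /h expr1 scalerA mulVf// scale1r subrr.
  rewrite /zs big_ord_recr/= -/(zs k) IH scalerA.
  have -> : h k.+2 * 2 = h k.+1 by rewrite /h exprSr mulfVK.
  by rewrite scalerBr opprB addrA addrAC.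
(* The weights of the first k terms sum to 1 - h k. An arbitrary p takes the
   missing weight, which makes the induction go through: p is replaced by its
   midpoint with the next term. *)
have part k p : Gam p -> Gam ((xs k, zs k) + h k *: p).
  elim: k p => [|k IH] p Gp.
    rewrite /xs /zs !big_ord0 /h expr0 scale1r.
    by rewrite [X in X + _](_ : _ = 0) ?add0r.
  have [Nk Lk] := vP k; have [_ Gg _ _] := gP (k, v k) Nk Lk.
  rewrite /xs /zs !big_ord_recr/=.
  have /IH : Gam (2^-1 *: g (k, v k) + 2^-1 *: p).
    move/convex_combE : cGam; apply => //.
    by rewrite -mulr2n -[_ *+ _]mulr_natr mulVf.
  rewrite scalerDr !scalerA -exprSr addrA.
  by case: (g (k, v k)) => gx gz.
have Gs k : Gam (xs k, zs k).
  by have := part k 0 Gam0; rewrite scaler0 addr0.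
have [|||x xsx _] := metric_telescope dX dXP xs (fun k => 2 * h k).
- move=> k; rewrite /xs big_ord_recr/= -/(xs k).
  have [Nk Lk] := vP k; have [+ _ _ _] := gP (k, v k) Nk Lk; rewrite /U/= => /ltW.
  have -> : 2 * h k - 2 * h k.+1 = h k by rewrite /h exprSr; lra.
  by rewrite -(dXi _ _ (xs k)) add0r addrC.
- by move=> k; rewrite mulr_ge0// ltW.
- rewrite -[0](mulr0 2); apply: cvgMr.
  by apply: cvg_expr; rewrite ger0_norm; lra.
have zsw : zs @ \oo --> w.
  move=> B; case: (dZP) => [_ nd _]; rewrite nd => -[e /= e0 eB].
  have [n _ nh] : \forall n \near \oo, `|h n| < e.
    apply: cvgr0_norm_lt => //.
    by apply: cvg_expr; rewrite ger0_norm; lra.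
  exists n => // k /= nk; apply: eB => /=.
  have [Nk _] := vP k; have [_ _ /(_ _ Nk) vk] := NP k.
  have := nh k nk; rewrite /= gtr0_norm// => hk.
  apply: le_lt_trans hk; apply: le_trans (ltW vk).
  rewrite zsE dZs -(dZi 0 (h k.+1 *: v k) (w - h k.+1 *: v k)) add0r.
  by rewrite [_ *: _ + _]addrC subrK.
exists x.
apply: (closed_cvg Gam clG (u_ := fun k => (xs k, zs k)) (F := \oo)).
  exact: nearW.
by apply: cvg_pair.
Qed.

End ursescu.

(** The case x0 = 0 is [ursescu0]; a translation in X preserves all the
    hypotheses. *)
Theorem ursescu {R : realType} {X Z : tvsType R} (Gam : set (X * Z)) (L : set Z)
    (x0 : X) : frechet X -> frechet Z ->
    convex_set (Gam : set (convex_lmodType (X * Z)%type)) -> closed Gam ->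
    linear_subspace L -> closed L -> (forall p, Gam p -> L p.2) -> Gam (x0, 0) ->
    absorbing L [set z | exists x, Gam (x, z)] ->
  exists2 W, nbhs 0 W & W `&` L `<=` [set z | exists x, Gam (x, z)].
Proof.
move=> fX fZ /convex_combE cG clG sL clL LG G0 LGam.
pose Gam' := [set p : X * Z | Gam (x0 + p.1, p.2)].
have [|||||W W0 WL] := @ursescu0 R X Z Gam' L _ _ sL _ clL _ _ fX fZ.
- apply/convex_combE => a b [x z] [y w] a0 b0 ab /= xz yw.
  rewrite /Gam' /=; have -> : x0 + (a *: x + b *: y) = a *: (x0 + x) + b *: (x0 + y).
    by rewrite !scalerDr addrACA -scalerDl ab scale1r.
  exact: (cG a b (x0 + x, z) (x0 + y, w)).
- by rewrite /Gam' /= addr0.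
- by move=> p /LG.
- move=> z /LGam[t t0 [x xz]]; exists t => //; exists (x - x0).
  by rewrite /Gam'/= addrC subrK.
- apply: (@preimage_closed _ _ (fun p : X * Z => (x0 + p.1, p.2)) Gam) => //.
  move=> p _; apply: cvg_pair => /=; last exact: cvg_snd.
  apply: (@continuous_addf _ _ _ (fun=> x0) fst) => q; first exact: cst_continuous.
  exact: cvg_fst.
by exists W => // z /WL[x xz]; exists (x0 + x).
Qed.

(** * Cones, epigraphs and separation *)

Section cones.
Context {R : realType} {V : tvsType R} (K : set V).
Context (convexK : convex_set (K : set (convex_lmodType V))).
Context (coneK : cone K).

Lemma cone_add x y : K x -> K y -> K (x + y).
Proof.
move=> Kx Ky; have -> : x + y = 2 *: (2^-1 *: x + 2^-1 *: y).
  by rewrite scalerDr !scalerA divff// !scale1r.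
apply: coneK => //; move/convex_combE : convexK; apply => //.
by rewrite -mulr2n -[_ *+ _]mulr_natr mulVf.
Qed.

Lemma cone_interior_add x y : K x -> K° y -> K° (x + y).
Proof.
move=> Kx Ky; have : nbhs (x + y) [set z | K (1 *: z - x)].
  by apply: nbhs_affine; rewrite scale1r addrAC subrr add0r.
apply: filterS => z /=; rewrite scale1r => Kz.
by rewrite -(subrK x z); exact: cone_add.
Qed.

Lemma cone_interior_scale (t : R) y : 0 < t -> K° y -> K° (t *: y).
Proof.
move=> t0 Ky; have : nbhs (t *: y) ( *:%R t @` K).
  by apply: nbhsZ => //; rewrite gt_eqF.
by apply: filterS => _ [z Kz <-]; apply: coneK => //; exact: ltW.
Qed.

Lemma interior_sub_scale x y : K° y -> exists2 t : R, 0 < t & K (y - t *: x).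
Proof.
move=> Ky; have : nbhs 0 [set z | K (1 *: z + y)].
  by apply: nbhs_affine; rewrite scaler0 add0r.
move=> /(nbhs0_absorbing _ x)[e e0 eK]; exists (e / 2); first exact: divr_gt0.
have := eK (- (e / 2)); rewrite /= normrN gtr0_norm ?divr_gt0//.
rewrite scale1r addrC scaleNr.
by apply; lra.
Qed.

End cones.

Lemma epiE {R : realType} {X Y : tvsType R} (K : set Y) (F : X -> ext Y) x y :
  epi K F (x, y) <-> exists2 y0, F x = Fin y0 & K (y - y0).
Proof.
split=> [[_ /= -> [k Kk]]|[y0 Fx Ky]].
  case: (F x) => //= y0 [<-]; exists y0 => //.
  by rewrite addrAC subrr add0r.
exists (F x) => //; exists (y - y0) => //.
by rewrite Fx /= addrC subrK.
Qed.

(** D plays the role of the epigraph of a convex function, bounded above by M on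
    W within L and nonnegative at 0. For (d, r) in D with - d / c in W there is
    (- d / c, r') in D with r' <= M; combining the two with weights
    1 / (1 + c) and c / (1 + c) gives a point of D over 0, whence
    r + c * r' >= 0 and M * c + r >= 0. This is the compatibility that
    [gauge_support] asks for, with the neighborhood - W. *)
Lemma bounded_value_subgradient {R : realType} {V : tvsType R}
    (D : set (V * R^o)) (L W : set V) (M : R) :
  convex_set (D : set (convex_lmodType (V * R^o)%type)) -> D !=set0 ->
  (forall r, D (0, r) -> 0 <= r) ->
  (forall p, D p -> L p.1) -> linear_subspace L -> nbhs 0 W -> 0 < M ->
  (forall w, W w -> L w -> exists2 r, r <= M & D (w, r)) ->
  exists f : contlin V R^o, forall d r, D (d, r) -> 0 <= f d + r.
Proof.
move=> cD D0 D0r DL sL W0 M0 WD.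
have [W' [W'0 W'W /convex_combE cW']] := convex_nbhs0 W W0.
pose U := [set x | W' (-1 *: x + 0)].
have U0 : nbhs 0 U by apply: nbhs_affine; rewrite scaler0 addr0.
have cU : convex_set (U : set (convex_lmodType V)).
  apply/convex_combE => a b x y a0 b0 ab; rewrite /U/= !addr0 !scaleN1r => Ux Uy.
  by rewrite opprD -!scalerN; exact: cW'.
have [|f [_ fD]] := gauge_support U D M U0 cU M0 D0 cD; last by exists f.
move=> d r c Dd c0; rewrite /U/= addr0 scaleN1r -scaleNr => /W'W Wd.
have [|r' r'M Dr'] := WD _ Wd.
  by apply: linear_subspaceZ => //; exact: (DL _ Dd).
have c1 : 0 < 1 + c by rewrite addr_gt0.
have := cD; move/convex_combE => /(_ (1 + c)^-1 (c / (1 + c)) _ _ _ _ _ Dd Dr').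
have -> : (1 + c)^-1 *: (d, r : R^o) + (c / (1 + c)) *: (- c^-1 *: d, r' : R^o) =
    (0, (1 + c)^-1 * (r + c * r')).
  congr pair => /=; last first.
    by rewrite /GRing.scale/= mulrDr mulrA [_^-1 * c]mulrC.
  rewrite scalerA -scalerDl [X in X *: _](_ : _ = 0) ?scale0r//.
  by field; rewrite !gt_eqF.
rewrite invr_ge0 divr_ge0 ?(ltW c0) ?(ltW c1)// => /(_ erefl erefl).
rewrite -{1}[_^-1]mul1r -mulrDl divff ?gt_eqF// => /(_ erefl) /D0r h.
have {}h : 0 <= r + c * r'.
  by rewrite -(pmulr_rge0 (_ : R) (x := (1 + c)^-1)) ?invr_gt0.
have : c * r' <= c * M by rewrite ler_pM2l.
lra.
Qed.

Section program.
Context {R : realType} {X Y Z : tvsType R}.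
Context (C : set X) (F : X -> ext Y) (G : X -> ext Z) (K : set Y) (S : set Z).
Context (convexC : convex_set (C : set (convex_lmodType X))).
Context (convexK : convex_set (K : set (convex_lmodType Y))) (coneK : cone K).
Context (convexF : K_convex K F).
Context (convexG : K_convex S G).

Lemma feasibleE x : feasible C G S x <-> C x /\ epi S G (x, 0).
Proof.
split=> [[Cx [_ [s Ss <-] Gx]]|[Cx /epiE[z Gx Sz]]]; split => //.
  by apply/epiE; exists (- s); rewrite ?Gx// sub0r opprK.
by exists z; rewrite ?Gx//; exists (- z); rewrite ?opprK// -sub0r.
Qed.

Lemma epi_comb (V : tvsType R) (H : X -> ext V) (Q : set V) (a b : R) x x' y y' :
  K_convex Q H -> 0 <= a -> 0 <= b -> a + b = 1 ->
  epi Q H (x, y) -> epi Q H (x', y') ->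
  epi Q H (a *: x + b *: x', a *: y + b *: y').
Proof.
by move=> /convex_combE cH a0 b0 ab h h'; exact: (cH a b (x, y) (x', y')).
Qed.

(** Apply [gauge_support] to W := k0 - K and to the constraints f q >= 1 for q in
    k0 + F(A) - ybar + K. If such a q were in c W with c < 1, some value of
    F on A would be below ybar by an element of K + (1 - c) *: k0, which is
    in int K, against weak minimality. As f k0 <= 1, the constraints at xbar
    give f >= 0 on K, and those at x give f ybar <= f (F x). *)
Lemma scalarization xbar ybar : K° !=set0 -> feasible C G S xbar ->
    F xbar = Fin ybar ->
    (forall x, feasible C G S x -> ~ ext_lt K (F x) (F xbar)) ->
  exists f : contlin Y R^o, [/\ forall k, K k -> 0 <= f k,
    forall k, K° k -> 0 < f k &
    forall x y, feasible C G S x -> F x = Fin y -> f ybar <= f y].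
Proof.
move=> [k0 Kk0] Axbar Fxbar opt.
have k0K : K k0 by exact: interior_subset.
have K0 : K 0 by rewrite -(scale0r k0); exact: coneK.
pose W := [set w | K (k0 - w)].
have W0 : nbhs 0 W.
  have : nbhs 0 [set w | K (-1 *: w + k0)].
    by apply: nbhs_affine; rewrite scaler0 add0r.
  by apply: filterS => w /=; rewrite scaleN1r addrC.
have cW : convex_set (W : set (convex_lmodType Y)).
  apply/convex_combE => a b x y a0 b0 ab Wx Wy.
  rewrite /W/= -[k0]scale1r -ab scalerDl opprD addrACA -!scalerBr.
  by move/convex_combE : convexK; apply.
pose D : set (Y * R^o) := [set p | p.2 = -1 /\ exists2 x,
   feasible C G S x & epi K F (x, p.1 + (ybar - k0))].
have Dbar k : K k -> D (k0 + k, -1).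
  move=> Kk; split => //; exists xbar => //; apply/epiE; exists ybar => //=.
  by rewrite addrAC addrA subrK addrC addrA addNr add0r.
have [|||f [fW fD]] := gauge_support W D 1 W0 cW ltr01.
- by exists (k0 + 0, -1); exact: Dbar.
- apply/convex_combE => a b [p r] [q t] a0 b0 ab /=.
  move=> [/= -> [x Ax Fx]] [/= -> [x' Ax' Fx']].
  split; first by rewrite /= -scalerDl ab scale1r.
  move: Ax Ax' => /feasibleE[Cx Gx] /feasibleE[Cx' Gx'].
  exists (a *: x + b *: x').
    apply/feasibleE; split; first by move/convex_combE : convexC; apply.
    have := epi_comb Z G S a b x x' 0 0 convexG a0 b0 ab Gx Gx'.
    by rewrite !scaler0 addr0.
  have := epi_comb Y F K a b _ _ _ _ convexF a0 b0 ab Fx Fx'.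
  by rewrite !(scalerDr _ _ (ybar - k0)) addrACA -scalerDl ab scale1r.
- move=> p r c [/= -> [x Ax /epiE[y Fx Kx]]] c0; rewrite /W/= => Kp.
  rewrite mul1r subr_ge0 leNgt; apply/negP => c1.
  apply: (opt x Ax); rewrite Fx Fxbar/=.
  exists (ybar - y); last by rewrite opprB.
  have Kc : K (c *: k0 - p).
    have -> : c *: k0 - p = c *: (k0 - c^-1 *: p).
      by rewrite scalerBr scalerA divff ?gt_eqF// scale1r.
    by apply: coneK => //; exact: ltW.
  have -> : ybar - y = (p + (ybar - k0) - y) + (c *: k0 - p) + (1 - c) *: k0.
    rewrite scalerBl scale1r -addrA [X in _ = _ + X]addrC.
    rewrite [X in _ = _ + X]addrA subrK.
    rewrite addrAC; congr (_ - _).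
    by rewrite addrC addrA subrK addrC subrK.
  apply: cone_interior_add => //; first exact: cone_add.
  by apply: cone_interior_scale => //; rewrite subr_gt0.
have fk0 : f k0 <= 1 by apply: fW; rewrite /W/= subrr.
have fK k : K k -> 0 <= f k.
  by move=> /Dbar /fD; rewrite linearD /=; lra.
exists f; split => //.
  move=> k Kk; have [t t0 /fK] := interior_sub_scale K k0 k Kk.
  have := fD _ _ (Dbar 0 K0).
  rewrite addr0 linearB linearZ /= => h; rewrite subr_ge0.
  by apply: lt_le_trans; rewrite mulr_gt0//; lra.
move=> x y Ax Fx; have : D (k0 + (y - ybar), -1).
  split => //; exists x => //; apply/epiE; exists y => //=.
  have -> : k0 + (y - ybar) + (ybar - k0) = y; last by rewrite subrr.
  by rewrite addrAC [k0 + _]addrC subrK addrC subrK.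
by move=> /fD; rewrite linearD linearB /=; lra.
Qed.

End program.

(** * Scalar Lagrange multipliers *)

Lemma affine_linear {R : realType} {V : tvsType R} (B : set V) :
  affine_set B -> B 0 -> linear_subspace B.
Proof.
move=> affB B0; apply/linear_subspaceE; split => // a x y Bx By.
have Bax : B (a *: x).
  by have := affB a x 0 Bx B0; rewrite scaler0 addr0.
have Bm := affB 2^-1 _ _ Bax By.
have := affB 2 _ _ Bm B0; rewrite scaler0 addr0 scalerDr.
rewrite [2 *: (2^-1 *: (a *: x))]scalerA [2 *: ((1 - _) *: y)]scalerA.
have -> : 2 * (1 - 2^-1) = 1 :> R by field.
by rewrite divff// !scale1r.
Qed.

Section lagrange.
Context {R : realType} {X Y Z : tvsType R}.
Context (C : set X) (F : X -> ext Y) (G : X -> ext Z) (K : set Y) (S : set Z).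
Context (convexC : convex_set (C : set (convex_lmodType X))).
Context (K0 : K 0).
Context (convexS : convex_set (S : set (convex_lmodType Z))) (coneS : cone S).
Context (S0 : S 0).
Context (convexF : K_convex K F).
Context (convexG : K_convex S G).
Context (xbar : X) (ybar : Y) (f : contlin Y R^o).
Context (Axbar : feasible C G S xbar).
Context (Fxbar : F xbar = Fin ybar).
Context (fK : forall k, K k -> 0 <= f k).
Context (fmin : forall x y, feasible C G S x -> F x = Fin y -> f ybar <= f y).

Definition scalar_multiplier := exists g : contlin Z R^o,
    (forall s, S s -> 0 <= g s) /\
    forall x y z, C x -> F x = Fin y -> G x = Fin z -> f ybar <= f y + g z.

(** Points (x, (z, r)) such that x is admissible after the constraint has been
    relaxed by z, at an excess cost of at most r over xbar. *)
Definition perturbation : set (X * (Z * R^o)) := [set p | exists y,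
  [/\ C p.1, F p.1 = Fin y, epi S G (p.1, p.2.1) & f y - f ybar <= p.2.2]].

Lemma perturbation_comb (a b : R) x x' z z' r r' : 0 <= a -> 0 <= b -> a + b = 1 ->
  perturbation (x, (z, r)) -> perturbation (x', (z', r')) ->
  perturbation (a *: x + b *: x', (a *: z + b *: z', a * r + b * r')).
Proof.
move=> a0 b0 ab [y /= [Cx Fx Gx yr]] [y' /= [Cx' Fx' Gx' yr']].
have : epi K F (a *: x + b *: x', a *: y + b *: y').
  by apply: epi_comb => //; apply/epiE; [exists y|exists y']; rewrite ?subrr.
move=> /epiE[y'' Fx'' Ky'']; exists y''; split => //=.
- by move/convex_combE : convexC; apply.
- exact: epi_comb.
- have := fK _ Ky''; rewrite linearB linearD !linearZ /= => h.
  have := ler_wpM2l a0 yr; have := ler_wpM2l b0 yr'.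
  have : f ybar = a * f ybar + b * f ybar by rewrite -mulrDl ab mul1r.
  move: h; rewrite /GRing.scale/=; lra.
Qed.

Lemma perturbation_bar s : S s -> perturbation (xbar, (s, 0)).
Proof.
move=> Ss; have /feasibleE[Cx /epiE[z Gx Sz]] := Axbar.
have Gs : epi S G (xbar, s).
  by apply/epiE; exists z => //; rewrite -[s]addr0 -addrA; exact: cone_add.
by exists ybar; split; rewrite //= subrr.
Qed.

(** The epigraph of the value function, apart from values that are not
    attained. *)
Definition value_epi : set (Z * R^o) := [set p | exists x, perturbation (x, p)].

(** The multiplier is nonnegative on S because relaxing the constraint by an
    element of S does not increase the value. *)
Lemma lagrange_multiplier (L W : set Z) (M : R) :
  (forall p, value_epi p -> L p.1) -> linear_subspace L -> nbhs 0 W -> 0 < M ->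
  (forall w, W w -> L w -> exists2 r, r <= M & value_epi (w, r)) ->
  scalar_multiplier.
Proof.
move=> DL sL W0 M0 WD.
have [|||g gD] := bounded_value_subgradient value_epi L W M _ _ _ DL sL W0 M0 WD.
- apply/convex_combE => a b [z r] [z' r'] a0 b0 ab [x xz] [x' xz'].
  by exists (a *: x + b *: x'); exact: perturbation_comb.
- by exists (0, 0), xbar; exact: perturbation_bar.
- move=> r [x [y /= [Cx Fx Gx yr]]]; apply: le_trans yr.
  by rewrite subr_ge0; apply: (fmin x) => //; apply/feasibleE.
exists g; split.
  move=> s Ss; have := gD s 0; rewrite addr0; apply.
  by exists xbar; exact: perturbation_bar.
move=> x y z Cx Fx Gx; have : value_epi (z, f y - f ybar).
  have Gxz : epi S G (x, z) by apply/epiE; exists z; rewrite ?subrr.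
  by exists x, y.
by move=> /gD; lra.
Qed.

Lemma value_set_epi v : proper_map F ->
  value_set C F G S v <-> exists r, value_epi (v, r).
Proof.
move=> [_ pF]; split.
  move=> [_ [x [[Cx Fx] _] <-] [s Ss]].
  case Gx : (G x) => [|z|] //= [zs].
  move: Fx (pF x); rewrite /dom/=; case Fx : (F x) => [|y|] // _ _.
  have Gxv : epi S G (x, v).
    by apply/epiE; exists z => //; rewrite -zs addrAC subrr add0r.
  by exists (f y - f ybar), x, y.
move=> [r [x [y /= [Cx Fx /epiE[z Gx Sz] _]]]].
exists (G x).
  by exists x => //; split; [split => //; rewrite /dom/= Fx|rewrite /dom/= Gx].
by exists (v - z) => //; rewrite Gx/= addrC subrK.
Qed.

(** Fixing the excess at 1 leaves a convex subset of X * Z, closed under suitable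
    assumptions, whose projection to Z carries the bound on the value
    function. *)
Definition unit_level : set (X * Z) := [set p | perturbation (p.1, (p.2, 1))].

(** Moving towards (xbar, 0), where the excess is 0, scales the excess down, so
    every perturbation in the domain of the value function has a positive
    multiple at which the value is at most 1. *)
Lemma value_epi_unit_level v r : value_epi (v, r) ->
  exists2 t, 0 < t & exists x, unit_level (x, t *: v).
Proof.
move=> [x xv]; have r0 : 0 < 1 + `|r| by rewrite ltr_wpDr.
exists (1 + `|r|)^-1; first by rewrite invr_gt0.
have t1 : (1 + `|r|)^-1 <= 1 by rewrite invf_le1// lerDl.
have t0 : 0 <= (1 + `|r|)^-1 by rewrite invr_ge0 ltW.
have := perturbation_comb _ _ _ _ _ _ _ _ t0 _ _ xv (perturbation_bar 0 S0).
move=> /(_ (1 - (1 + `|r|)^-1)); rewrite subr_ge0 => /(_ t1).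
rewrite addrC subrK => /(_ erefl)[y [/= Cx Fx Gx yr]].
eexists; exists y; split; [exact: Cx|exact: Fx| |] => /=.
  by move: Gx; rewrite scaler0 addr0.
apply: le_trans yr _; rewrite mulr0 addr0 mulrC ler_pdivrMr// mul1r.
by apply: le_trans (ler_norm _) _; rewrite lerDr.
Qed.

(** For w in W := S - s0 the point x0 is admissible for the perturbation w, so the
    excess cost of x0 bounds the value function on W. *)
Lemma interior_multiplier x0 y0 s0 : C x0 -> F x0 = Fin y0 -> G x0 = Fin (- s0) ->
  S° s0 ->
  scalar_multiplier.
Proof.
move=> Cx0 Fx0 Gx0 Ss0.
apply: (@lagrange_multiplier setT [set w | S (1 *: w + s0)]
  (1 + `|f y0 - f ybar|)) => //.
- by apply/linear_subspaceE.
- by apply: nbhs_affine; rewrite scaler0 add0r.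
- move=> w /=; rewrite scale1r => Sw _; exists (f y0 - f ybar).
    by apply: le_trans (ler_norm _) _; rewrite lerDr.
  have Gw : epi S G (x0, w) by apply/epiE; exists (- s0); rewrite ?opprK.
  by exists x0, y0.
Qed.

Lemma unit_level_multiplier L W : proper_map F -> (value_set C F G S `<=` L) ->
  linear_subspace L -> nbhs 0 W ->
  W `&` L `<=` [set z | exists x, unit_level (x, z)] ->
  scalar_multiplier.
Proof.
move=> pF EL sL W0 WL; apply: (@lagrange_multiplier L W 1) => //.
  by move=> [v r] vr; apply: EL; apply/value_set_epi => //; exists r.
by move=> w Ww Lw; exists 1 => //; exact: (WL w (conj Ww Lw)).
Qed.

Lemma convex_unit_level :
  convex_set (unit_level : set (convex_lmodType (X * Z)%type)).
Proof.
apply/convex_combE => a b [x z] [x' z'] a0 b0 ab xz xz'.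
have := perturbation_comb a b x x' z z' 1 1 a0 b0 ab xz xz'.
by rewrite !mulr1 ab.
Qed.

(** Lower semicontinuity of f o F, used at the level f ybar + 1, together with
    closedness of C and of the epigraph of G, makes [unit_level] closed. It
    projects into conic E 0, for E the set [value_set C F G S]; this is a closed
    subspace by the condition on sqri E, and the projection is absorbing in it,
    so [ursescu] applies. *)
Lemma frechet_multiplier : proper_map F -> frechet X -> frechet Z -> closed C ->
  lower_semicontinuous (dual_comp f F) -> K_epi_closed S G ->
  sqri (value_set C F G S) 0 ->
  scalar_multiplier.
Proof.
move=> pF fX fZ clC lscF clG [E0 sL clL].
have EL : value_set C F G S `<=` conic (value_set C F G S) 0.
  move=> v Ev; exists 1; first by rewrite /= ler01.
  by exists v => //; rewrite subr0 scale1r.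
have [||||W W0 WL] := ursescu unit_level _ xbar fX fZ convex_unit_level _ sL clL.
- have -> : unit_level = (fst @^-1` C) `&`
      (fst @^-1` [set x | (dual_comp f F x <= (1 + f ybar)%:E)%E]) `&` epi S G.
    apply/seteqP; split=> [[x z] [y /= [Cx Fx Gx yr]]|[x z] [[/= Cx Fx] Gx]].
      by split => //; split => //=; rewrite /dual_comp Fx lee_fin -lerBlDr.
    move: Fx (pF.2 x); rewrite /dual_comp; case Fx : (F x) => [|y|] // + _.
    by rewrite lee_fin -lerBlDr => yr; exists y.
  apply: closedI => //; apply: closedI.
    by apply: preimage_closed => // p _; exact: cvg_fst.
  apply: preimage_closed => [p _|]; first exact: cvg_fst.
  rewrite -openC.
  have := (lower_semicontinuousP _).1 lscF (1 + f ybar).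
  congr open; apply/seteqP; split => x /=; rewrite ltNge; [exact/negP|].
  by move/negP.
- move=> [x z] /= xz; apply: EL; apply/value_set_epi => //.
  by exists 1, x.
- have [y [Cx Fx Gx yr]] := perturbation_bar 0 S0; exists y; split => //=.
  by apply: le_trans yr _.
- move=> _ [t /= t0 [v Ev <-]].
  have [r vr] := (value_set_epi _ pF).1 Ev.
  have [s s0 [x xv]] := value_epi_unit_level _ _ vr.
  move: t0; rewrite le_eqVlt => /predU1P[<-|t0].
    exists 1 => //; exists xbar; rewrite scale0r scaler0.
    have [y [Cx Fx Gx yr]] := perturbation_bar 0 S0; exists y; split => //=.
    by apply: le_trans yr _.
  exists (s / t); first exact: divr_gt0.
  by exists x; rewrite subr0 scalerA divfK// gt_eqF.
exact: unit_level_multiplier EL sL W0 WL.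
Qed.

(** Write E for [value_set C F G S]. As 0 is in E, aff E is a linear subspace
    and contains lin E. A neighborhood of 0 relative to aff E is therefore
    absorbing in lin E, and so is the projection of [unit_level]. *)
Lemma finite_dim_multiplier : proper_map F -> hausdorff_space Z ->
  finite_dim (lin (value_set C F G S)) -> ri (value_set C F G S) 0 ->
  scalar_multiplier.
Proof.
move=> pF hZ fdL riE.
set E := value_set C F G S.
have E0 : E 0 by exact: interior_subset riE.
have EL : E `<=` lin E by exact: sub_smallest.
have affE : E `<=` aff E by exact: sub_smallest.
have [W W0 WE] : exists2 W, nbhs 0 W & W `&` aff E `<=` E.
  have [W W0 WE] := (nbhs_subspace_ex E (affE 0 E0)).1 riE.
  by exists W => //; rewrite -WE; exact: subIsetl.
have sL := lin_subspace E.
have Laff : lin E `<=` aff E.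
  apply: (smallest_sub _ affE); apply: (affine_linear _ _ (affE 0 E0)).
  by move=> t x y Ex Ey B BE; exact: (BE.1 t x y (Ex B BE) (Ey B BE)).
have [||W' W'0 W'L] := finite_dim_absorbing (lin E)
  [set z | exists x, unit_level (x, z)] hZ sL fdL.
- apply/convex_combE => a b z z' a0 b0 ab [x xz] [x' xz'].
  exists (a *: x + b *: x').
  by move/convex_combE : convex_unit_level => /(_ a b (x, z) (x', z')); apply.
- move=> z Lz; have [e e0 eW] := nbhs0_absorbing W z W0.
  have : E ((e / 2) *: z).
    apply: WE; split; first by apply: eW; rewrite gtr0_norm ?divr_gt0//; lra.
    by apply: Laff; exact: (linear_subspaceZ _ _ _ sL Lz).
  move=> /(value_set_epi _ pF)[r /value_epi_unit_level[t t0 [x xz]]].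
  exists (t * (e / 2)); first by rewrite mulr_gt0 ?divr_gt0.
  by exists x; rewrite -scalerA.
exact: unit_level_multiplier EL sL W'0 W'L.
Qed.

End lagrange.

(** * The vector problem *)

Section duality.
Context {R : realType} {X Y Z : tvsType R}.
Context (C : set X) (F : X -> ext Y) (G : X -> ext Z) (K : set Y) (S : set Z).
Context (convexK : convex_set (K : set (convex_lmodType Y))) (coneK : cone K).
Context (K0 : K 0).
Context (xbar : X) (ybar : Y).
Context (Axbar : feasible C G S xbar).
Context (Fxbar : F xbar = Fin ybar).
Context (pF : proper_map F) (pG : proper_map G).

Definition lagrange_condition (T : contlin Z Y) := forall x, C x ->
  ~ (Fin @` (-%R @` K°))
      (ext_add (ext_add (F x) (lin_comp T G x)) (ext_opp (F xbar))).

Lemma weak_solutionE : weak_solution C F G K S xbar <->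
  forall x, feasible C G S x -> ~ ext_lt K (F x) (F xbar).
Proof.
split=> [[_ [_ [opt _]]] x Ax|opt]; first by apply: opt; exists x.
split => //; split; first by exists xbar.
split; first by move=> _ [x Ax <-]; exact: opt.
by move=> v lt_v; exists (F xbar) => //; exists xbar.
Qed.

Lemma lagrange_condition_weak_solution (T : contlin Z Y) :
  positive_operators K S T -> lagrange_condition T ->
  weak_solution C F G K S xbar.
Proof.
move=> Tpos cT; apply/weak_solutionE => x Ax; have [Cx [_ [s Ss <-] Gx]] := Ax.
have := cT x Cx; rewrite Fxbar /lin_comp -Gx; move: (pF.2 x).
case: (F x) => [|y|] //= _; last by move=> _ [].
move=> h [u Ku uE]; apply: h.
exists (y + T (- s) - ybar) => //; exists (T s + u).
  by apply: cone_interior_add => //; apply: Tpos; exists s.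
by rewrite linearN /= opprD uE addrCA addrA.
Qed.

(** From left to right the element of the weak supremum is -ybar itself: the
    value of the negated Lagrangian at xbar is -ybar + T s with T s in K, so
    whatever is strictly below -ybar is strictly below that value. From
    right to left, an m in the weak supremum with -ybar in m + K is not
    strictly below any value of the negated Lagrangian, and neither is
    -ybar. *)
Lemma lagrange_conditionE (T : contlin Z Y) : positive_operators K S T ->
  lagrange_condition T <->
  plus_set (conjugate K (map_add (map_add F (ext_indic C)) (lin_comp T G))
    (contlin0 X Y)) K (ext_opp (F xbar)).
Proof.
move=> Tpos; rewrite /lagrange_condition Fxbar /= /conjugate.
pose H x := ext_add (Fin (contlin0 X Y x))
  (ext_opp (map_add (map_add F (ext_indic C)) (lin_comp T G) x)).
have HE x y z : C x -> F x = Fin y -> G x = Fin z -> H x = Fin (- (y + T z)).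
  move=> Cx Fx Gx; rewrite /H /map_add /ext_indic /lin_comp (mem_set Cx) Fx Gx /=.
  by rewrite addr0 add0r.
split=> [cT|].
  exists (Fin (- ybar)); last by exists 0; rewrite //= addr0.
  split=> [_ [x _ <-]|v lt_v].
    rewrite -/(H x); have [Cx|nCx] := pselect (C x); last first.
      rewrite /H /map_add /ext_indic memNset//.
      by case: (F x) => [|y|]; case: (lin_comp T G x) => [|z|] [].
    have [Fx|Fx] := pselect (F x = PInfty); first by rewrite /H /map_add Fx => -[].
    have [Gx|Gx] := pselect (G x = PInfty).
      rewrite /H /map_add /lin_comp Gx.
      by case: (ext_add (F x) _) => [|y|] [].
    have [y Fy] : exists y, F x = Fin y.
      by move: Fx (pF.2 x); case: (F x) => [|y|] // _ _; exists y.
    have [z Gz] : exists z, G x = Fin z.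
      by move: Gx (pG.2 x); case: (G x) => [|z|] // _ _; exists z.
    have := cT x Cx; rewrite (HE x _ _ Cx Fy Gz) Fy /lin_comp Gz /=.
    move=> h [u Ku uE]; apply: h; exists (y + T z - ybar) => //; exists u => //.
    by rewrite uE opprK addrC.
  have [Cxbar [_ [s Ss <-] Gxbar]] := Axbar.
  exists (H xbar); first by exists xbar.
  rewrite (HE _ _ _ Cxbar Fxbar (esym Gxbar)).
  case: v lt_v => [|v|] //= [u Ku uE]; exists (T s + u).
    by apply: cone_interior_add => //; apply: Tpos; exists s.
  by rewrite opprD uE !opprK addrC addrA (linearN T).
move=> [m [m_max _] [k Kk mk]] x Cx [_ [u Ku <-]].
case: m m_max mk => [|m|] // m_max [mk].
case Fx : (F x) => [|y|] //; rewrite /lin_comp; case Gx : (G x) => [|z|] //= [uE].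
apply: (m_max (H x)); first by exists x.
rewrite (HE _ _ _ Cx Fx Gx) /=; exists (k + u); first exact: cone_interior_add.
have -> : m = - ybar - k by rewrite -mk addrK.
by rewrite opprD uE opprK addrC -addrA [RHS]addrC.
Qed.

End duality.

Theorem theorem5p2 (R : realType) (X Y Z : tvsType R)
  (hausX : hausdorff_space X) (hausY : hausdorff_space Y)
  (hausZ : hausdorff_space Z)
  (K : set Y) (closedK : closed K) (pointedK : pointed_cone K)
  (convexK : convex_set (K : set (convex_lmodType Y))) (coneK : cone K)
  (intK : K° !=set0)
  (S : set Z) (S0 : S !=set0) (closedS : closed S)
  (convexS : convex_set (S : set (convex_lmodType Z))) (coneS : cone S)
  (C : set X) (C0 : C !=set0)
  (convexC : convex_set (C : set (convex_lmodType X)))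
  (F : X -> ext Y) (properF : proper_map F) (convexF : K_convex K F)
  (G : X -> ext Z) (properG : proper_map G) (convexG : K_convex S G)
  (xbar : X) (xbarP : (feasible C G S `&` dom F) xbar)
  (regularity :
    [\/ exists2 x0, (C `&` dom F) x0 & (Fin @` (-%R @` S°)) (G x0),
        [/\ frechet X, frechet Z & closed C] /\
        [/\ forall ystar : contlin Y R^o,
              lower_semicontinuous (dual_comp ystar F),
            K_epi_closed S G
          & sqri (value_set C F G S) 0]
      | finite_dim (lin (value_set C F G S)) /\ ri (value_set C F G S) 0]) :
  (weak_solution C F G K S xbar <->
     exists2 T : contlin Z Y, positive_operators K S T &
       plus_set
         (conjugate K (map_add (map_add F (ext_indic C)) (lin_comp T G))
            (contlin0 X Y)) K
         (ext_opp (F xbar)))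
  /\
  (weak_solution C F G K S xbar <->
     exists2 T : contlin Z Y, positive_operators K S T &
       forall x, C x ->
         ~ (Fin @` (-%R @` K°))
             (ext_add (ext_add (F x) (lin_comp T G x)) (ext_opp (F xbar)))).
Proof.
have K0 : K 0.
  by case: intK => k /interior_subset Kk; rewrite -(scale0r k); exact: coneK.
have {}S0 : S 0 by case: S0 => s Ss; rewrite -(scale0r s); exact: coneS.
have [Axbar Fxbar] := xbarP.
have {Fxbar}[ybar Fxbar] : exists ybar, F xbar = Fin ybar.
  move: Fxbar (properF.2 xbar); rewrite /dom/=.
  by case: (F xbar) => [|y|] // _ _; exists y.
suff gP : weak_solution C F G K S xbar <->
    exists2 T : contlin Z Y, positive_operators K S T &
      lagrange_condition C F G K xbar T.
  have fgE := lagrange_conditionE C F G K S convexK coneK K0 xbar ybar Axbar Fxbar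
    properF properG.
  split => //; split=> [/gP[T Tpos cT]|[T Tpos cT]].
    by exists T => //; exact/fgE.
  by apply/gP; exists T => //; exact/fgE.
split=> [|[T Tpos cT]]; last first.
  exact: (lagrange_condition_weak_solution C F G K S convexK coneK xbar ybar Axbar
    Fxbar properF T Tpos cT).
move=> /(weak_solutionE C F G K S xbar Axbar) opt.
have [f [fK fintK fmin]] := scalarization C F G K S convexC convexK coneK convexF
  convexG xbar ybar intK Axbar Fxbar opt.
have [g [gS gmin]] : scalar_multiplier C F G S ybar f.
  case: regularity => [[x0 [Cx0 Fx0] [_ [s0 Ss0 <-] Gx0]]|
    [[fX fZ clC] [lsc epiG sq]]|[fd riE]].
  - have [y0 Fy0] : exists y0, F x0 = Fin y0.
      move: Fx0 (properF.2 x0); rewrite /dom/=.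
      by case: (F x0) => [|y|] // _ _; exists y.
    exact: (interior_multiplier C F G K S convexC K0 convexS coneS S0 convexF
      convexG xbar ybar f Axbar Fxbar fK fmin _ _ _ Cx0 Fy0 (esym Gx0) Ss0).
  - exact: (frechet_multiplier C F G K S convexC K0 convexS coneS S0 convexF
      convexG xbar ybar f Axbar Fxbar fK fmin properF fX fZ clC
      (lsc f) epiG sq).
  - exact: (finite_dim_multiplier C F G K S convexC K0 convexS coneS S0 convexF
      convexG xbar ybar f Axbar Fxbar fK fmin properF hausZ fd riE).
have [k0 Kk0] := intK.
have [||T TE] := @contlin_pack R Z Y (fun z => g z *: ((f k0)^-1 *: k0)).
- move=> a x y; rewrite linearP /= scalerDl; congr (_ + _).
  exact: (esym (scalerA _ _ _)).
- apply: continuous_scalef; first exact: contlin_continuous.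
  by move=> x; exact: cst_continuous.
(* The normalization of T is chosen for this identity. *)
have fT z : f (T z) = g z.
  by rewrite TE /= !linearZ /= /GRing.scale/= mulVf ?mulr1// gt_eqF// fintK.
exists T.
  move=> _ [s Ss <-]; rewrite TE; apply: (coneK _ _ (gS _ Ss)).
  apply: coneK; last exact: (interior_subset Kk0).
  by rewrite invr_ge0; apply: ltW; exact: fintK.
move=> x Cx; rewrite Fxbar /lin_comp.
case Fx : (F x) => [|y|]; case Gx : (G x) => [|z|] [_ [k Kk <-]] //= [kE].
have := gmin _ _ _ Cx Fx Gx; rewrite -(fT z).
have := fintK k Kk.
have : f (- k) = f y + f (T z) - f ybar by rewrite kE linearB linearD.
by rewrite linearN /=; lra.
Qed.
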